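(* Let $A$ be an (augmented, unital) DG algebra over a field $\mathbf{k}$ whose Hochschild cohomology $HH^*(A,A^\vee)$ is a BV-algebra, with product denoted $\cup$. Then the cyclic cohomology $HC^*(A)$ and the negative cyclic cohomology $HC^*_-(A)$ are naturally gravity algebras, where the brackets are given by $$\{x_1,\dots,x_k\}:=i(b(x_1)\cup\cdots\cup b(x_k)),$$ $b$ and $i$ being the maps to and from $HH^*(A,A^\vee)$ in the respective Connes long exact sequence.
   Context: $C_*(A,A)=A\otimes T(s\bar A)$ is the normalized Hochschild chain complex of $A$ ($\bar A=A/\mathbf{k}$, $s$ lowers degree by one), and $C^*(A,A^\vee)=\mathrm{Hom}_{\mathbf{k}}(A\otimes T(s\bar A),\mathbf{k})$ is the Hochschild cochain complex with coefficients in $A^\vee=\mathrm{Hom}_{\mathbf{k}}(A,\mathbf{k})$, with differential $d^\vee$ and cohomology $HH^*(A,A^\vee)$. $B^\vee(\phi)=(-1)^{|\phi|}\phi\circ B$ is the dual of the Connes operator $B(a_0[a_1,\dots,a_n])=\sum_{i=1}^{n+1}\pm1[a_i,\dots,a_n,a_0,\dots,a_{i-1}]$ (Koszul signs). With $v$ a formal variable of degree $-2$, the cyclic cochain complex is $CC^*(A)=(C^*(A,A^\vee)\otimes\mathbf{k}[v],\,d^\vee+vB^\vee)$ and the negative cyclic cochain complex is $CC^*_-(A)=(C^*(A,A^\vee)\otimes\mathbf{k}[v,v^{-1}]]/v\mathbf{k}[v],\,d^\vee+vB^\vee)$; their cohomologies are $HC^*(A)$ and $HC^*_-(A)$. The Connes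 long exact sequence for cyclic cohomology is $$\cdots\to HC^{k+2}(A)\to HC^{k}(A)\xrightarrow{\,b\,}HH^{k+1}(A,A^\vee)\xrightarrow{\,i\,}HC^{k+1}(A)\to\cdots,$$ and there is an analogous sequence for $HC^*_-(A)$. The composite $b\circ i$ is the operator $B^\vee$ on $HH^*(A,A^\vee)$, and the BV-operator of the BV-algebra $HH^*(A,A^\vee)$ is understood to be $\Delta=b\circ i$. A gravity algebra is a graded vector space $L^*$ equipped with maps $\{\cdot,\dots,\cdot\}:L^{\otimes k}\to L$ satisfying the identities $$\sum_{i<j}(-1)^{\epsilon_{i,j}}\{\{x_i,x_j\},x_1,\dots,\hat x_i,\dots,\hat x_j,\dots,x_k,y_1,\dots,y_l\}=\begin{cases}0,&l=0,\\ \{\{x_1,\dots,x_k\},y_1,\dots,y_l\},&l>0,\end{cases}$$ where $\epsilon_{i,j}=|x_i|\sum_{r=1}^{i-1}|x_r|+|x_j|\sum_{r=1,\,r\ne i}^{j-1}|x_r|$ and a hat denotes omission. A BV-algebra is a graded commutative associative algebra with an operator $\Delta$ of degree $+1$ such that $\Delta^2=0$ and $\Delta(abc)=\Delta(ab)c+(-1)^{|a|}a\Delta(bc)+(-1)^{(|a|-1)|b|}b\Delta(ac)-\Delta(a)bc-(-1)^{|a|}a\Delta(b)c-(-1)^{|a|+|b|}ab\Delta(c)$.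
   Formalization: In the gravity signs the degree |x| of a class x is taken to be the degree of b(x) in HH^*(A,A^∨), so HC^*_-(A) is regraded by one; HC^*(A) carries the grading of its complex, where b has degree 0 and i degree +1. With unshifted degrees, when b has degree +1, the identities fail. *)

(* Defs.v *)
From HB Require Import structures.
From mathcomp Require Import all_boot all_order all_algebra.
From mathcomp Require Import ring_quotient generic_quotient.
From mathcomp Require Import boolp classical_sets functions.

Set Implicit Arguments.
Unset Strict Implicit.
Unset Printing Implicit Defensive.

Import GRing.Theory.
Local Open Scope ring_scope.

(** * Graded vector spaces *)

(* A graded vector space is a family [V : int -> lmodType k]; equations
   between homogeneous elements whose degrees agree only propositionally are
   stated componentwise in the direct sum, through [comp]. *)
Section Graded.
Context {k : fieldType}.
Implicit Types V W : int -> lmodType k.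

Definition homog V : Type := {n : int & V n}.

Definition hdeg V (x : homog V) : int := tag x.

Definition comp V (n : int) (x : homog V) : V n :=
  untag (0 : V n) (fun y : V n => y) x.

Definition hmap V W (r : int -> int) (f : forall n, V n -> W (r n))
    (x : homog V) : homog W :=
  Tagged W (f (tag x) (tagged x)).

Definition hmul V (m : forall p q, V p -> V q -> V (p + q)) (x y : homog V) :
    homog V :=
  Tagged V (m (tag x) (tag y) (tagged x) (tagged y)).

Definition bilinear_product V (m : forall p q, V p -> V q -> V (p + q)) : Prop :=
  (forall p q (y : V q), linear (fun x : V p => m p q x y)) /\
  (forall p q (x : V p), linear (m p q x)).

End Graded.

(** * Augmented unital DG algebras (differential of degree +1) *)

Record augDGA (k : fieldType) := AugDGA {
  agr :> int -> lmodType k;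
  amul : forall p q, agr p -> agr q -> agr (p + q);
  aone : agr 0;
  adif : forall p, agr p -> agr (p + 1);
  aaug : agr 0 -> k;
  amul_bilinear : bilinear_product amul;
  adif_linear : forall p, linear (@adif p);
  amulA : forall x y z : homog agr,
    hmul amul x (hmul amul y z) = hmul amul (hmul amul x y) z;
  amul1 : forall x : homog agr, hmul amul x (Tagged agr aone) = x;
  a1mul : forall x : homog agr, hmul amul (Tagged agr aone) x = x;
  adif_adif : forall p (x : agr p), adif (adif x) = 0;
  adif_leibniz : forall (x y : homog agr) n,
    comp n (hmap adif (hmul amul x y)) =
    comp n (hmul amul (hmap adif x) y)
    + (-1 : k) ^ hdeg x *: comp n (hmul amul x (hmap adif y));
  (* The augmentation is a DG algebra morphism to [k] (in degree 0), hence is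
     extended by 0 to the components of nonzero degree. *)
  aaug_linear : linear (aaug : agr 0 -> k^o);
  aaug_one : aaug aone = 1;
  aaug_mul : forall x y : homog agr,
    aaug (comp 0 (hmul amul x y)) = aaug (comp 0 x) * aaug (comp 0 y);
  aaug_dif : forall x : homog agr, aaug (comp 0 (hmap adif x)) = 0
}.

(** * Cohomology *)

(* A complex with differential of degree -1, given by an ambient space, the
   subspaces of homogeneous elements, and the differential on each of them.
   That the differential squares to 0 plays no role in forming
   ker / (ker :&: im) and is not recorded. *)
Record precomplex (k : fieldType) := Precomplex {
  cobj :> lmodType k;
  cdeg : int -> cobj -> Prop;
  cdiff : int -> cobj -> cobj;
  cdeg0 : forall n, cdeg n 0;
  cdegP : forall n a x y, cdeg n x -> cdeg n y -> cdeg n (a *: x + y);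
  cdiff_linear : forall n, linear (cdiff n)
}.

Section Cohomology.
Context {k : fieldType} (X : precomplex k) (n : int).

Lemma cdiffP m a (x y : X) : cdiff m (a *: x + y) = a *: cdiff m x + cdiff m y.
Proof. exact: cdiff_linear. Qed.

Lemma cdiff0 m : cdiff m (0 : X) = 0.
Proof.
have := cdiffP m 1 (0 : X) 0; rewrite !scale1r !addr0 => /eqP.
by rewrite addrC -subr_eq subrr => /eqP <-.
Qed.

Definition cocycle : {pred X} := fun x => `[< cdeg n x /\ cdiff n x = 0 >].

Lemma cocycle_submod : subsemimod_closed cocycle.
Proof.
have C0 : 0 \in cocycle by apply/asboolP; split; [exact: cdeg0 | exact: cdiff0].
have CP a x y : x \in cocycle -> y \in cocycle -> a *: x + y \in cocycle.
  move=> /asboolP[xn dx] /asboolP[yn dy]; apply/asboolP; split.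
    exact: cdegP.
  by rewrite cdiffP dx dy scaler0 addr0.
split; [split=> // x y xC yC | move=> a x xC].
- by rewrite -[x]scale1r; exact: CP.
- by rewrite -[a *: x]addr0; exact: CP.
Qed.

HB.instance Definition _ := GRing.isSubmodClosed.Build k X cocycle cocycle_submod.

Record cocycles : Type := Cocycle {
  cocycle_val : X;
  _ : cocycle_val \in cocycle
}.

HB.instance Definition _ := [isSub for cocycle_val].
HB.instance Definition _ := [Choice of cocycles by <:].
HB.instance Definition _ := [SubChoice_isSubLmodule of cocycles by <:].

Definition coboundary : {pred cocycles} :=
  fun z => `[< exists2 y : X, cdeg (n + 1) y & cdiff (n + 1) y = val z >].

Lemma coboundary_submod : subsemimod_closed coboundary.
Proof.
have C0 : 0 \in coboundary.
  by apply/asboolP; exists 0; [exact: cdeg0 | rewrite cdiff0 raddf0].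
have CP a x y : x \in coboundary -> y \in coboundary -> a *: x + y \in coboundary.
  move=> /asboolP[x' xn dx] /asboolP[y' yn dy]; apply/asboolP.
  exists (a *: x' + y'); first exact: cdegP.
  by rewrite cdiffP dx dy linearP.
split; [split=> // x y xC yC | move=> a x xC].
- by rewrite -[x]scale1r; exact: CP.
- by rewrite -[a *: x]addr0; exact: CP.
Qed.

HB.instance Definition _ :=
  GRing.isSubmodClosed.Build k cocycles coboundary coboundary_submod.

Local Open Scope quotient_scope.

Definition cohomology : Type := Quotient.quot (coboundary : zmodClosed cocycles).

HB.instance Definition _ := Choice.on cohomology.
HB.instance Definition _ := EqQuotient.on cohomology.
HB.instance Definition _ := GRing.Zmodule.on cohomology.
HB.instance Definition _ := ZmodQuotient.on cohomology.

Definition coh_scale (a : k) : cohomology -> cohomology :=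
  lift_op1 cohomology ( *:%R a).

Lemma pi_coh_scale a : {morph \pi_cohomology : x / a *: x >-> coh_scale a x}.
Proof.
move=> x; unlock coh_scale; apply/eqP.
rewrite -Quotient.idealrBE -scalerBr rpredZ //.
by rewrite Quotient.idealrBE reprK.
Qed.

Fact coh_scaleA a b v : coh_scale a (coh_scale b v) = coh_scale (a * b) v.
Proof. by rewrite -[v]reprK -!pi_coh_scale scalerA. Qed.

Fact coh_scale1 : left_id 1 coh_scale.
Proof. by move=> v; rewrite -[v]reprK -pi_coh_scale scale1r. Qed.

Fact coh_scaleDr : right_distributive coh_scale +%R.
Proof.
move=> a u v; rewrite -[u]reprK -[v]reprK -raddfD -!pi_coh_scale.
by rewrite scalerDr raddfD.
Qed.

Fact coh_scaleDl v : {morph coh_scale^~ v : a b / a + b}.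
Proof. by move=> a b; rewrite -[v]reprK -!pi_coh_scale scalerDl raddfD. Qed.

HB.instance Definition _ := GRing.Zmodule_isLmodule.Build k cohomology
  coh_scaleA coh_scale1 coh_scaleDr coh_scaleDl.

(* [x] is a cocycle of degree [n] whose class is [c]. *)
Definition represents (x : X) (c : cohomology) : Prop :=
  exists2 z : cocycles, val z = x & \pi_cohomology z = c.

End Cohomology.

Definition coh (k : fieldType) (X : precomplex k) : int -> lmodType k :=
  fun n => cohomology X n.

(* The map induced by a chain map [f] carrying degree [p] to degree [q]. As for
   [connecting] below, the set given to [xget] is a singleton for a chain map
   (resp. a short exact sequence of complexes); 0 is never a default value. *)
Definition induced (k : fieldType) (X Y : precomplex k) (f : X -> Y)
    (p q : int) (c : coh X p) : coh Y q :=
  xget 0 [set c' | exists2 x, represents x c & represents (f x) c']%classic.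

(* The connecting map of a short exact sequence 0 -> X -f-> Y -g-> Z -> 0:
   lift a representative of [c] along [g] to an element of degree [r], apply
   the differential of Y, and pull back along [f]. *)
Definition connecting (k : fieldType) (X Y Z : precomplex k)
    (f : X -> Y) (g : Y -> Z) (p r q : int) (c : coh Z p) : coh X q :=
  xget 0 [set c' | exists y x,
    [/\ cdeg r y, represents (g y) c, cdiff r y = f x & represents x c']]%classic.

(** * The Hochschild complex *)

Section Hochschild.
Context {k : fieldType} (A : augDGA k).

(* The word [(a0, [:: a1; ...; an])] of homogeneous elements stands for the
   generator a0[a1, ..., an] of the tensor product of A with T(s A/k). *)
Definition word : Type := (homog A * seq (homog A))%type.

(* A formal linear combination of generators. *)
Definition chain : Type := seq (k * word).

Definition hone : homog A := Tagged (agr A) (aone A).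

Definition sdeg (s : seq (homog A)) : int := \sum_(x <- s) (hdeg x - 1).

Definition wdeg (w : word) : int := hdeg w.1 + sdeg w.2.

Definition ksgn (n : int) : k := (-1) ^ n.

(* d(a0[a1,...,an]) = d a0[a1,...,an]
     - sum_{1<=i<=n} (-1)^{e_{i-1}} a0[a1,...,d ai,...,an]
     + (-1)^{|a0|} a0 a1[a2,...,an]
     + sum_{1<=i<n} (-1)^{e_i} a0[a1,...,ai a(i+1),...,an]
     - (-1)^{e_{n-1} (|an|-1)} an a0[a1,...,a(n-1)],
   where e_i = |a0| + (|a1|-1) + ... + (|ai|-1). *)
Definition hochschild_d (w : word) : chain :=
  let: (a, s) := w in
  let d := hmap (@adif k A) in
  let mul := hmul (@amul k A) in
  (1, (d a, s))
  :: [seq (- ksgn (wdeg (a, take i s)),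
           (a, take i s ++ d (nth a s i) :: drop i.+1 s)) | i <- iota 0 (size s)]
  ++ if s is x :: t then
       (ksgn (hdeg a), (mul a x, t))
       :: [seq (ksgn (wdeg (a, take i.+1 s)),
                (a, take i s ++ mul (nth a s i) (nth a s i.+1) :: drop i.+2 s))
          | i <- iota 0 (size s).-1]
       ++ [:: (- ksgn (wdeg (a, belast x t) * (hdeg (last x t) - 1)),
               (mul (last x t) a, belast x t))]
     else [::].

(* B(a0[a1,...,an]) = sum_{1<=i<=n+1} +-1[ai,...,an,a0,...,a(i-1)], with the
   Koszul sign of the cyclic rotation of sa0, ..., san. *)
Definition connes_B (w : word) : chain :=
  let s := w.1 :: w.2 in
  [seq (ksgn (sdeg (take i s) * sdeg (drop i s)), (hone, rot i s))
  | i <- iota 1 (size s)].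

(* A linear form on the tensor product of A with T(s A/k) is a function of
   words that is linear in each letter and vanishes when one of a1, ..., an is
   the unit. It has degree [n] when it is supported on chains of degree [n]
   (so B^vee raises the degree by one, and d^vee lowers it by one). *)
Record is_cochain (n : int) (phi : word -> k^o) : Prop := IsCochain {
  cochain_head : forall p (c : k) (x y : A p) s,
    phi (Tagged (agr A) (c *: x + y), s) = c * phi (Tagged (agr A) x, s) + phi (Tagged (agr A) y, s);
  cochain_tail : forall p (c : k) (x y : A p) a s t,
    phi (a, s ++ Tagged (agr A) (c *: x + y) :: t) =
    c * phi (a, s ++ Tagged (agr A) x :: t) + phi (a, s ++ Tagged (agr A) y :: t);
  cochain_unit : forall a s t, phi (a, s ++ hone :: t) = 0;
  cochain_deg : forall w, wdeg w != n -> phi w = 0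
}.

(* phi |-> (-1)^{|phi|} phi o T, for phi of degree [n]. *)
Definition dual_op (T : word -> chain) (n : int) (phi : word -> k^o) : word -> k^o :=
  fun w => ksgn n * \sum_(c <- T w) c.1 * phi c.2.

Definition d_dual := dual_op hochschild_d.
Definition B_dual := dual_op connes_B.

Lemma is_cochain0 n : is_cochain n 0.
Proof. by split=> *; rewrite /= ?mulr0 ?addr0. Qed.

Lemma is_cochainP n a phi psi :
  is_cochain n phi -> is_cochain n psi -> is_cochain n (a *: phi + psi).
Proof.
have E w : (a *: phi + psi) w = a * phi w + psi w by [].
have R (c u v u' v' : k) :
    a * (c * u + v) + (c * u' + v') = c * (a * u + u') + (a * v + v').
  by rewrite !mulrDr !mulrA [a * c]mulrC addrACA.
move=> [h1 t1 u1 d1] [h2 t2 u2 d2]; split=> *; rewrite !E.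
- by rewrite h1 h2 R.
- by rewrite t1 t2 R.
- by rewrite u1 u2 mulr0 addr0.
- by rewrite d1 // d2 // mulr0 addr0.
Qed.

Lemma dual_op_linear T n : linear (dual_op T n).
Proof.
move=> a phi psi; apply/funext => w.
have E u : (a *: phi + psi) u = a * phi u + psi u by [].
transitivity (a * dual_op T n phi w + dual_op T n psi w) => //.
rewrite /dual_op mulrCA -mulrDr; congr (_ * _).
rewrite big_distrr -big_split /=; apply: eq_bigr => c _.
by rewrite E mulrDr mulrCA.
Qed.

Definition hochschild_cx : precomplex k :=
  @Precomplex k (word -> k^o) is_cochain d_dual is_cochain0 is_cochainP
    (dual_op_linear hochschild_d).

Definition HH : int -> lmodType k := coh hochschild_cx.

(** * Cyclic and negative cyclic cochains *)

(* [x : nat -> _] stands for sum_j (x j) v^j in the cyclic complex, where all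
   but finitely many coefficients vanish, and for sum_j (x j) v^{-j} in the
   negative cyclic complex, where k[v, v^{-1}]]/v k[v] = k[[v^{-1}]] and the
   tensor product is completed. As |v| = -2, the coefficients of an element of
   degree [n] have degrees n + 2j and n - 2j respectively. *)

Notation coeffs := (nat -> word -> k^o).

Definition mulv_pos (x : coeffs) : coeffs := fun j => if j is i.+1 then x i else 0.
Definition mulv_neg (x : coeffs) : coeffs := fun j => x j.+1.

Definition is_cyclic_cochain (n : int) (x : coeffs) : Prop :=
  (forall j : nat, is_cochain (n + j.*2%:Z) (x j)) /\
  (exists N : nat, forall j : nat, (N <= j)%N -> x j = 0).

Definition is_neg_cyclic_cochain (n : int) (x : coeffs) : Prop :=
  forall j : nat, is_cochain (n - j.*2%:Z) (x j).

(* d^vee + v B^vee *)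
Definition cyclic_diff (n : int) (x : coeffs) : coeffs :=
  (fun j => d_dual (n + j.*2%:Z) (x j))
  + mulv_pos (fun j => B_dual (n + j.*2%:Z) (x j)).

Definition neg_cyclic_diff (n : int) (x : coeffs) : coeffs :=
  (fun j => d_dual (n - j.*2%:Z) (x j))
  + mulv_neg (fun j => B_dual (n - j.*2%:Z) (x j)).

Lemma is_cyclic_cochain0 n : is_cyclic_cochain n 0.
Proof. by split; [move=> j; exact: is_cochain0 | exists 0%N]. Qed.

Lemma is_cyclic_cochainP n a x y :
  is_cyclic_cochain n x -> is_cyclic_cochain n y -> is_cyclic_cochain n (a *: x + y).
Proof.
move=> [xn [N xN]] [yn [M yM]]; split; first by move=> j; exact: is_cochainP.
exists (maxn N M) => j; rewrite geq_max => /andP[Nj Mj].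
transitivity (a *: x j + y j) => //.
by rewrite xN // yM // scaler0 addr0.
Qed.

Lemma is_neg_cyclic_cochain0 n : is_neg_cyclic_cochain n 0.
Proof. by move=> j; exact: is_cochain0. Qed.

Lemma is_neg_cyclic_cochainP n a x y :
  is_neg_cyclic_cochain n x -> is_neg_cyclic_cochain n y ->
  is_neg_cyclic_cochain n (a *: x + y).
Proof. by move=> xn yn j; exact: is_cochainP. Qed.

Lemma cyclic_diff_linear n : linear (cyclic_diff n).
Proof.
move=> a x y; apply/funext => j.
have L (T : word -> chain) m (f g : word -> k^o) :
  dual_op T m (a *: f + g) = a *: dual_op T m f + dual_op T m g.
  exact: dual_op_linear.
case: j => [|j].
  transitivity (d_dual (n + (0%N).*2%:Z) (a *: x 0%N + y 0%N) + 0) => //.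
  transitivity (a *: (d_dual (n + (0%N).*2%:Z) (x 0%N) + 0)
    + (d_dual (n + (0%N).*2%:Z) (y 0%N) + 0)) => //.
  by rewrite !addr0 /d_dual L.
transitivity (d_dual (n + (j.+1).*2%:Z) (a *: x j.+1 + y j.+1)
  + B_dual (n + j.*2%:Z) (a *: x j + y j)) => //.
transitivity (a *: (d_dual (n + (j.+1).*2%:Z) (x j.+1) + B_dual (n + j.*2%:Z) (x j))
  + (d_dual (n + (j.+1).*2%:Z) (y j.+1) + B_dual (n + j.*2%:Z) (y j))) => //.
by rewrite /d_dual /B_dual !L scalerDr addrACA.
Qed.

Lemma neg_cyclic_diff_linear n : linear (neg_cyclic_diff n).
Proof.
move=> a x y; apply/funext => j.
have L (T : word -> chain) m (f g : word -> k^o) :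
  dual_op T m (a *: f + g) = a *: dual_op T m f + dual_op T m g.
  exact: dual_op_linear.
transitivity (d_dual (n - j.*2%:Z) (a *: x j + y j)
  + B_dual (n - (j.+1).*2%:Z) (a *: x j.+1 + y j.+1)) => //.
transitivity (a *: (d_dual (n - j.*2%:Z) (x j) + B_dual (n - (j.+1).*2%:Z) (x j.+1))
  + (d_dual (n - j.*2%:Z) (y j) + B_dual (n - (j.+1).*2%:Z) (y j.+1))) => //.
by rewrite /d_dual /B_dual !L scalerDr addrACA.
Qed.

Definition cyclic_cx : precomplex k :=
  @Precomplex k coeffs is_cyclic_cochain cyclic_diff
    is_cyclic_cochain0 is_cyclic_cochainP cyclic_diff_linear.

Definition neg_cyclic_cx : precomplex k :=
  @Precomplex k coeffs is_neg_cyclic_cochain neg_cyclic_diff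
    is_neg_cyclic_cochain0 is_neg_cyclic_cochainP neg_cyclic_diff_linear.

Definition HC : int -> lmodType k := coh cyclic_cx.
Definition HCneg : int -> lmodType k := coh neg_cyclic_cx.

(** * The maps b and i of the Connes long exact sequences *)

Definition at_v0 (x : coeffs) : word -> k^o := x 0%N.
Definition in_v0 (phi : word -> k^o) : coeffs := fun j => if j is 0%N then phi else 0.

(* From 0 -> CC^{*+2} -v-> CC^* -> C^* -> 0. *)
Definition hc_b (n : int) : HC n -> HH n :=
  @induced k cyclic_cx hochschild_cx at_v0 n n.
Definition hc_i (n : int) : HH n -> HC (n + 1) :=
  @connecting k cyclic_cx cyclic_cx hochschild_cx mulv_pos at_v0 n n (n + 1).

(* From 0 -> C^{*+2} -> CC_-^{*+2} -v-> CC_-^* -> 0. *)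
Definition hcneg_b (n : int) : HCneg n -> HH (n + 1) :=
  @connecting k hochschild_cx neg_cyclic_cx neg_cyclic_cx in_v0 mulv_neg
    n (n + 2) (n + 1).
Definition hcneg_i (n : int) : HH n -> HCneg n :=
  @induced k hochschild_cx neg_cyclic_cx in_v0 n n.

Definition bv_delta (n : int) (x : HH n) : HH (n + 1) := hc_b (hc_i x).

End Hochschild.

(** * BV-algebras and gravity algebras *)

Section Structures.
Context {k : fieldType}.

Record is_BV_algebra (V : int -> lmodType k)
    (cup : forall p q, V p -> V q -> V (p + q))
    (Delta : forall n, V n -> V (n + 1)) : Prop := IsBVAlgebra {
  bv_bilinear : bilinear_product cup;
  bv_assoc : forall x y z : homog V,
    hmul cup x (hmul cup y z) = hmul cup (hmul cup x y) z;
  bv_comm : forall (x y : homog V) n,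
    comp n (hmul cup x y) =
    ksgn (hdeg x * hdeg y) *: comp n (hmul cup y x);
  bv_linear : forall n, linear (Delta n);
  bv_square : forall n (x : V n), Delta _ (Delta _ x) = 0;
  bv_seven : forall (a b c : homog V) n,
    let D := hmap Delta in
    let mul := hmul cup in
    comp n (D (mul (mul a b) c)) =
      comp n (mul (D (mul a b)) c)
      + ksgn (hdeg a) *: comp n (mul a (D (mul b c)))
      + ksgn ((hdeg a - 1) * hdeg b) *: comp n (mul b (D (mul a c)))
      - comp n (mul (mul (D a) b) c)
      - ksgn (hdeg a) *: comp n (mul (mul a (D b)) c)
      - ksgn (hdeg a + hdeg b) *: comp n (mul (mul a b) (D c))
}.

(* Brackets {x1,...,xk}, k >= 2, on the regraded space L with
   L^{n+s} = V^n; they are written [br x1 [:: x2; ...; xk]]. The degree |x|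
   entering the signs is the one in L, and the brackets have degree 1. *)
Section Gravity.
Variables (V : int -> lmodType k) (s : int).
Variable br : homog V -> seq (homog V) -> homog V.

Definition gdeg (x : homog V) : int := hdeg x + s.

Definition gravity_sign (w : seq int) (i j : nat) : k :=
  ksgn (nth 0 w i * \sum_(0 <= r < i) nth 0 w r
        + nth 0 w j * \sum_(0 <= r < j | r != i) nth 0 w r).

Definition omit2 (T : Type) (x0 : T) (w : seq T) (i j : nat) : seq T :=
  [seq nth x0 w r | r <- iota 0 (size w) & (r != i) && (r != j)].

Record is_gravity_algebra : Prop := IsGravityAlgebra {
  gravity_degree : forall x xs, (0 < size xs)%N ->
    gdeg (br x xs) = gdeg x + \sum_(y <- xs) gdeg y + 1;
  gravity_linear_head : forall p (c : k) (x y : V p) xs n, (0 < size xs)%N ->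
    comp n (br (Tagged V (c *: x + y)) xs) =
    c *: comp n (br (Tagged V x) xs) + comp n (br (Tagged V y) xs);
  gravity_linear_tail : forall p (c : k) (x y : V p) z xs ys n,
    comp n (br z (xs ++ Tagged V (c *: x + y) :: ys)) =
    c *: comp n (br z (xs ++ Tagged V x :: ys))
    + comp n (br z (xs ++ Tagged V y :: ys));
  (* [w] is x1, ..., xk with k >= 2, and [ys] is y1, ..., yl; the last
     hypothesis, k + l >= 3, says that every bracket has at least two
     entries. *)
  gravity_identity : forall (x1 : homog V) (xs ys : seq (homog V)) n,
    (0 < size xs)%N -> (1 < size xs + size ys)%N ->
    let w := x1 :: xs in
    \sum_(0 <= j < size w) \sum_(0 <= i < j)
      gravity_sign [seq gdeg x | x <- w] i j *:
        comp n (br (br (nth x1 w i) [:: nth x1 w j]) (omit2 x1 w i j ++ ys)) =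
    if ys is [::] then 0 else comp n (br (br x1 xs) ys)
}.

End Gravity.

(* {x1,...,xk} = i (b x1 \cup ... \cup b xk) *)
Definition bi_bracket (V W : int -> lmodType k)
    (cup : forall p q, W p -> W q -> W (p + q))
    (b : homog V -> homog W) (i : homog W -> homog V)
    (x : homog V) (xs : seq (homog V)) : homog V :=
  i (foldl (hmul cup) (b x) [seq b y | y <- xs]).

End Structures.

(* Main.v *)
Require Import Defs.
From mathcomp Require Import all_boot all_order all_algebra.
From mathcomp Require Import ring_quotient generic_quotient.
From mathcomp Require Import boolp classical_sets functions ring.
Set Implicit Arguments.
Unset Strict Implicit.
Unset Printing Implicit Defensive.
Import GRing.Theory.
Local Open Scope ring_scope.

(* Exactness gives i b = 0, and b i = Delta in both sequences, so every b x is
   killed by Delta. For elements a1, ..., ak killed by Delta, the seven-term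
   identity gives, by induction on k,
     Delta (a1 ... ak) = sum_{i<j} +- Delta (ai aj) a1 ... ^ai ... ^aj ... ak.
   Applying this to a_r = b x_r, multiplying by b y1 ... b yl and applying i
   gives the gravity identities; for l = 0 the left-hand side is i b i (...) = 0.

   That b, i are well defined and that b i is the class of B^vee both times
   only requires B^vee to preserve normalized cochains, B^vee B^vee = 0 and
   d^vee B^vee = - B^vee d^vee. The last identity is reduced to two facts on the
   bar differential: it is a coderivation for deconcatenation and, up to the
   product at the junction, a derivation for concatenation. *)

Local Notation comp := Defs.comp.

(** * The Connes operator on Hochschild cochains *)

Section KoszulSigns.
Context {k : fieldType}.
Local Notation sgn := (@ksgn k).

Lemma ksgnD m n : sgn (m + n) = sgn m * sgn n.
Proof. by rewrite /ksgn expfzDr // oppr_eq0 oner_eq0. Qed.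

Lemma ksgn0 : sgn 0 = 1.
Proof. exact: expr0z. Qed.

Lemma ksgn1 : sgn 1 = -1.
Proof. exact: expr1z. Qed.

Lemma ksgn_double m : sgn (m * 2) = 1.
Proof. by rewrite /ksgn mulrC -exprz_exp -[2]/(2%N%:Z) -exprnP sqrrN expr1n exp1rz. Qed.

(** The usual form of a sign comparison below: the even discrepancy [c * 2] is given explicitly and
    [ring] checks the exponents. *)
Lemma ksgn_eq c m n : m = n + c * 2 -> sgn m = sgn n.
Proof. by move=> ->; rewrite ksgnD ksgn_double mulr1. Qed.

Lemma ksgn_sq m : sgn m * sgn m = 1.
Proof. by rewrite -ksgnD -[RHS](ksgn_double m); congr (sgn _); ring. Qed.

Lemma ksgnB m n : sgn (m - n) = sgn m * sgn n.
Proof. by rewrite -ksgnD; apply: (ksgn_eq (c := - n)); ring. Qed.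

End KoszulSigns.

Section Components.
Context {k : fieldType} {V : int -> lmodType k}.

Lemma comp_Tagged n (x : V n) : comp n (Tagged V x) = x.
Proof. by rewrite /Defs.comp (untagE _ _ (erefl : tag (Tagged V x) = n)). Qed.

Lemma Tagged_comp (x : homog V) n : hdeg x = n -> Tagged V (comp n x) = x.
Proof. by move=> <-; case: x => m x; rewrite comp_Tagged. Qed.

End Components.

(** * The bar differential and cyclic rotations of words *)

Section BarConstruction.
Context {k : fieldType} (A : augDGA k).

Local Notation letters := (seq (homog A)).
Local Notation da := (hmap (@adif k A)).
Local Notation mul := (hmul (@amul k A)).
Local Notation one := (hone A).
Local Notation sgn := (@ksgn k).
Local Notation sg x := (sgn (hdeg x - 1)).
Implicit Types (s t u v : letters) (x y z : homog A) (h : letters -> k).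

Lemma sdeg_cons x s : sdeg (x :: s) = hdeg x - 1 + sdeg s.
Proof. exact: big_cons. Qed.

Lemma ksgn_sdeg_cons x s : sgn (sdeg (x :: s)) = sg x * sgn (sdeg s).
Proof. by rewrite sdeg_cons ksgnD. Qed.

Lemma sdeg_nil : sdeg ([::] : letters) = 0.
Proof. exact: big_nil. Qed.

Lemma sdeg_cat s t : sdeg (s ++ t) = sdeg s + sdeg t.
Proof. exact: big_cat. Qed.

Lemma sdeg_rcons s x : sdeg (rcons s x) = sdeg s + (hdeg x - 1).
Proof. by rewrite -cats1 sdeg_cat sdeg_cons sdeg_nil addr0. Qed.

Definition merge_head x t h : k := if t is y :: t' then h (mul x y :: t') else 0.

(* A formal sum of words is represented by the functional "h |-> sum of the
   values of h". Here the sum is the bar differential of t: internal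
   differentials minus products of neighbours, with Koszul signs. *)
Fixpoint bar_d t h : k :=
  if t is x :: t' then
    h (da x :: t') +
    sg x * (bar_d t' (fun l => h (x :: l)) - merge_head x t' h)
  else 0.

(* The sum of g u v over all u, v with t = u ++ v. *)
Fixpoint splits t (g : letters -> letters -> k) : k :=
  if t is x :: t' then g [::] t + splits t' (fun u v => g (x :: u) v)
  else g [::] [::].

(* Signed value of h on v ++ u with the last letter of v and the first letter
   of u multiplied. *)
Fixpoint glue v u h : k :=
  if v is x :: v' then
    sg x * (if v' is [::] then merge_head x u h
            else glue v' u (fun l => h (x :: l)))
  else 0.

(** All words occurring in [bar_d t] are nonempty of degree [sdeg t + 1]. Signs depending on the
    degree of the word can thus be treated as constants under [bar_d]. *)
Lemma eq_bar_d t h h' :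
  (forall x s, sdeg (x :: s) = sdeg t + 1 -> h (x :: s) = h' (x :: s)) ->
  bar_d t h = bar_d t h'.
Proof.
elim: t h h' => [|x t IH] h h' E //=; congr (_ + _ * (_ - _)).
- by apply: E; rewrite !sdeg_cons /hdeg /=; ring.
- by apply: IH => y s Ds; apply: E; rewrite sdeg_cons Ds (sdeg_cons x t) addrA.
- by case: t {IH} E => //= y t E; apply: E; rewrite !sdeg_cons /hdeg /=; ring.
Qed.

Lemma eq_splits t g g' :
  (forall u v, u ++ v = t -> g u v = g' u v) -> splits t g = splits t g'.
Proof.
elim: t g g' => [|x t IH] g g' E /=; first exact: E.
by rewrite E //; congr (_ + _); apply: IH => u v uv; apply: E; rewrite /= uv.
Qed.

Lemma bar_dD t h h' : bar_d t (fun l => h l + h' l) = bar_d t h + bar_d t h'.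
Proof.
elim: t h h' => [|x t IH] h h' /=; first by rewrite addr0.
rewrite IH; case: t {IH} => [|y t] /=; ring.
Qed.

Lemma bar_dZ t c h : bar_d t (fun l => c * h l) = c * bar_d t h.
Proof.
elim: t h => [|x t IH] h /=; first by rewrite mulr0.
rewrite IH; case: t {IH} => [|y t] /=; ring.
Qed.

Lemma splitsD t g g' :
  splits t (fun u v => g u v + g' u v) = splits t g + splits t g'.
Proof. by elim: t g g' => [|x t IH] g g' //=; rewrite IH addrACA. Qed.

Lemma splitsZ t c g : splits t (fun u v => c * g u v) = c * splits t g.
Proof. by elim: t g => [|x t IH] g //=; rewrite IH mulrDr. Qed.

Lemma splits_rcons t z g :
  splits (rcons t z) g = splits t (fun u v => g u (rcons v z)) + g (rcons t z) [::].
Proof. by elim: t g => [|x t IH] g //=; rewrite IH addrA. Qed.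

(* The bar differential is a coderivation for deconcatenation. *)
Lemma bar_d_splits t g :
  bar_d t (fun l => splits l g) =
  splits t (fun u v => bar_d u (fun l => g l v)
                       + sgn (sdeg u) * bar_d v (fun l => g u l)).
Proof.
elim: t g => [|x t IH] g /=; first by rewrite mulr0 addr0.
rewrite bar_dD IH sdeg_nil ksgn0 mul1r add0r.
rewrite [X in _ = _ + X](_ : _ = splits t (fun u v => g (da x :: u) v +
    (sg x * (bar_d u (fun l => g (x :: l) v) + sgn (sdeg u) * bar_d v (fun l => g (x :: u) l))
     + sg x * - merge_head x u (fun l => g l v)))); last first.
  by apply: eq_splits => u v _; rewrite ksgn_sdeg_cons /=; ring.
rewrite 2![in RHS]splitsD 2![in RHS]splitsZ.
(* When [x] is multiplied with the next letter, the split of the new word with empty left part has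
   the product on the right; it belongs to the split of [x :: t] into [[::]] and itself, hence the
   correction term. *)
have -> : splits t (fun u v => - merge_head x u (fun l => g l v)) =
    - (merge_head x t (fun l => splits l g) - merge_head x t (g [::])).
  case: t {IH} => [|y t] /=; first by rewrite subrr.
  rewrite oppr0 add0r [X in - X]addrAC subrr add0r.
  by rewrite -[RHS]mulN1r -splitsZ; apply: eq_splits => u v _; rewrite mulN1r.
ring.
Qed.

(* The bar differential is a derivation for concatenation, up to the product
   of the letters at the junction. *)
Lemma bar_d_cat v u h :
  bar_d (v ++ u) h = bar_d v (fun l => h (l ++ u))
    + sgn (sdeg v) * bar_d u (fun l => h (v ++ l)) - glue v u h.
Proof.
elim: v h => [|x v IH] h /=; first by rewrite sdeg_nil ksgn0; ring.
rewrite IH ksgn_sdeg_cons.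
by case: v {IH} => [|y v] /=; ring.
Qed.

Lemma glue_rcons v z u h :
  glue (rcons v z) u h =
  sgn (sdeg (rcons v z)) * merge_head z u (fun l => h (v ++ l)).
Proof.
elim: v h => [|x v IH] h /=; first by rewrite sdeg_cons sdeg_nil addr0.
rewrite IH ksgn_sdeg_cons -mulrA.
by case: v {IH}.
Qed.

(** The Connes operator without its unit head. An empty [u] is skipped because it would repeat the
    identity rotation, already given by an empty [v]. *)
Definition rotations t h : k :=
  splits t (fun u v => if u is [::] then 0 else sgn (sdeg u * sdeg v) * h (v ++ u)).

(* The product of the last letter with the first one, after a cyclic rotation. *)
Definition wrap t h : k :=
  if t is x :: t' then
    if t' is y :: t'' then
      sgn ((1 + sdeg (belast x t')) * (hdeg (last x t') - 1))
      * h (mul (last x t') x :: behead (belast x t'))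
    else 0
  else 0.

(** The differential of a rotated word [v ++ u] consists of those of [u] and [v], which are the
    splits of [bar_d t], and of one product at the junction, that of the last letter of [t] with the
    first. The junction terms are the rotations of [wrap t]. *)
Lemma rotations_bar_d t h :
  rotations t (fun l => bar_d l h) =
  bar_d t (fun l => rotations l h) - wrap t (fun l => rotations l h).
Proof.
rewrite /rotations bar_d_splits.
pose junction u v : k :=
  if u is [::] then 0 else sgn (sdeg u * sdeg v) * glue v u h.
have -> : wrap t (fun l => splits l (fun u v =>
     if u is [::] then 0 else sgn (sdeg u * sdeg v) * h (v ++ u))) =
   splits t junction.
  case: t => [|x t] //=; rewrite add0r.
  case/lastP: t => [|t z];  first by rewrite /junction /= mulr0 addr0.
  rewrite add0r splits_rcons belast_rcons last_rcons /= mulr0 addr0.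
  rewrite (_ : (if rcons t z is _ :: _ then _ else 0) =
    sgn ((1 + sdeg (x :: t)) * (hdeg z - 1)) * splits t (fun u v =>
       sgn (sdeg (mul z x :: u) * sdeg v) * h (v ++ mul z x :: u))); last by case: (t).
  rewrite -splitsZ; apply: eq_splits => u v <-.
  rewrite glue_rcons mulrA -ksgnD [RHS]mulrA -ksgnD; congr (_ * _).
  apply: (ksgn_eq (c := (hdeg z - 1) * sdeg v)).
  rewrite !sdeg_cons sdeg_rcons sdeg_cat (_ : hdeg (mul z x) = hdeg z + hdeg x) //.
  ring.
apply: (canRL (addrK _)); rewrite -splitsD.
apply: eq_splits => -[|x u] v _.
  have -> : bar_d v (fun=> 0) = 0.
    rewrite -[RHS](mul0r (bar_d v (fun=> 0))) -bar_dZ.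
    by apply: eq_bar_d => *; rewrite mul0r.
  by rewrite /junction /= mulr0 !addr0.
rewrite bar_d_cat /junction mulrBr subrK mulrDr addrC; congr (_ + _).
  rewrite mulrA -ksgnD -bar_dZ; apply: eq_bar_d => y s Ds.
  by rewrite Ds mulrDl mul1r.
rewrite -!bar_dZ; apply: eq_bar_d => y s Ds.
rewrite mulrA -ksgnD Ds; congr (_ * _); apply: (ksgn_eq (c := - sdeg (x :: u))); ring.
Qed.

Lemma splits_behead_nil t g :
  splits t (fun u v => if u is [::] then 0 else g u v) = splits t g - g [::] t.
Proof. by case: t => [|x t] /=; [rewrite subrr | rewrite [RHS]addrAC subrr]. Qed.

Lemma splits_belast_nil t g :
  splits t (fun u v => if v is [::] then 0 else g u v) = splits t g - g t [::].
Proof.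
elim: t g => [|x t IH] g /=; first by rewrite subrr.
by rewrite (IH (fun u => g (x :: u))) addrA.
Qed.

(** Moving the cut one letter to the left maps the splits with nonempty left part bijectively onto
    those with nonempty right part. *)
Lemma splits_shift x t g :
  splits t (fun u v => g (belast x u) (last x u :: v)) =
  splits (x :: t) (fun u v => if v is [::] then 0 else g u v).
Proof.
elim: t x g => [|y t IH] x g /=; first by rewrite addr0.
by rewrite (IH y (fun u => g (x :: u))).
Qed.

(* The two terms of d(1[t1,...,tn]) in which the unit is multiplied by t1 or
   by tn. *)
Definition rotation_defect t h : k :=
  if t is x :: t' then
    h t - sgn (sdeg (belast x t') * (hdeg (last x t') - 1)) * h (last x t' :: belast x t')
  else 0.

Lemma sdeg_belast x t : sdeg (belast x t) + (hdeg (last x t) - 1) = sdeg (x :: t).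
Proof. by rewrite -sdeg_rcons -lastI. Qed.

(* The two terms of a rotation cancel against those of its neighbours. *)
Lemma rotations_defect t h : rotations t (rotation_defect^~ h) = 0.
Proof.
case: t => [|x t] //; pose g u v := sgn (sdeg u * sdeg v) * h (v ++ u).
transitivity (splits (x :: t) (fun u v => if u is [::] then 0 else g u v)
   - splits t (fun u v => g (belast x u) (last x u :: v))); last first.
  (* The two sums leave out different splits, but [g [::] (x :: t)] and [g (x :: t) [::]] are both
     the identity rotation. *)
  rewrite (splits_shift x t g) (splits_belast_nil (x :: t)) splits_behead_nil /g /=.
  by rewrite sdeg_nil mul0r mulr0 cats0 subrr.
rewrite /rotations /= -addrA -mulN1r -splitsZ -splitsD; congr (_ + _).
apply: eq_splits => u v _; rewrite /g mulN1r.
have -> : rotation_defect (v ++ x :: u) h = h (v ++ x :: u) -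
    sgn ((sdeg v + sdeg (belast x u)) * (hdeg (last x u) - 1))
    * h (last x u :: v ++ belast x u).
  case: v => [|y v] /=; first by rewrite sdeg_nil add0r.
  by rewrite belast_cat last_cat /= -(cat_rcons (last y v)) -lastI sdeg_cat.
rewrite mulrBr mulrA -ksgnD; congr (_ - _ * _).
apply: (ksgn_eq (c := sdeg v * (hdeg (last x u) - 1))).
rewrite -sdeg_belast (sdeg_cons (last x u)); ring.
Qed.

Lemma sum_iota1 n (F : nat -> k) :
  \sum_(i <- iota 1 n) F i = \sum_(i <- iota 0 n) F i.+1.
Proof. by rewrite -[1%N]addn0 iotaDl big_map. Qed.

Lemma sum_iota_recl n (F : nat -> k) :
  \sum_(i <- iota 0 n.+1) F i = F 0%N + \sum_(i <- iota 0 n) F i.+1.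
Proof. by rewrite -sum_iota1 (_ : iota 0 n.+1 = 0%N :: iota 1 n) // big_cons. Qed.

Lemma splits_iota t g :
  splits t g = \sum_(i <- iota 0 (size t).+1) g (take i t) (drop i t).
Proof.
elim: t g => [|x t IH] g; first by rewrite big_seq1.
by rewrite [size _]/= sum_iota_recl /= IH.
Qed.

Lemma sum_connes_B (w : word A) (phi : word A -> k) :
  \sum_(c <- connes_B w) c.1 * phi c.2 =
  rotations (w.1 :: w.2) (fun l => phi (one, l)).
Proof.
rewrite /connes_B big_map /rotations splits_iota sum_iota_recl add0r sum_iota1.
by apply: eq_bigr.
Qed.

Lemma bar_d_iota a t h :
  bar_d t h =
  \sum_(i <- iota 0 (size t))
    sgn (sdeg (take i t)) * h (take i t ++ da (nth a t i) :: drop i.+1 t)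
  - \sum_(i <- iota 0 (size t).-1) sgn (sdeg (take i.+1 t))
      * h (take i t ++ mul (nth a t i) (nth a t i.+1) :: drop i.+2 t).
Proof.
elim: t h => [|x t IH] h; first by rewrite !big_nil subrr.
rewrite [bar_d _ _]/= IH [size _]/= sum_iota_recl /=.
rewrite sdeg_nil ksgn0 mul1r drop0 -[RHS]addrA; congr (_ + _).
under [in RHS]eq_bigr do rewrite ksgn_sdeg_cons -mulrA.
rewrite -big_distrr /= -addrA mulrDr; congr (_ + _); rewrite -opprD mulrN; congr (- _).
case: t {IH} => [|y t]; first by rewrite !big_nil addr0 mulr0.
rewrite [size _]/= [_.-1]/= sum_iota_recl /=.
under [in RHS]eq_bigr do rewrite ksgn_sdeg_cons -mulrA.
by rewrite -big_distrr /= sdeg_cons sdeg_nil addr0 drop0 mulrDr [LHS]addrC.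
Qed.

Lemma sum_hochschild_d a s (phi : word A -> k) :
  \sum_(c <- hochschild_d (a, s)) c.1 * phi c.2 =
  phi (da a, s) - sgn (hdeg a) * bar_d s (fun l => phi (a, l))
  + (if s is x :: t then sgn (hdeg a) * phi (mul a x, t)
       - sgn (wdeg (a, belast x t) * (hdeg (last x t) - 1))
         * phi (mul (last x t) a, belast x t)
     else 0).
Proof.
rewrite /hochschild_d big_cons big_cat big_map /= mul1r -!addrA; congr (_ + _).
rewrite (bar_d_iota a) mulrBr opprB -[in RHS]addrA [RHS]addrCA.
have W u : sgn (wdeg (a, u)) = sgn (hdeg a) * sgn (sdeg u) by rewrite ksgnD.
congr (_ + _).
  by rewrite big_distrr -sumrN; apply: eq_bigr => i _; rewrite /= W mulNr mulrA.
case: s => [|x t]; first by rewrite !big_nil mulr0 addr0.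
rewrite big_cons big_cat big_seq1 big_map /= mulNr [RHS]addrC -!addrA.
congr (_ + _); rewrite addrC; congr (_ + _).
by rewrite big_distrr; apply: eq_bigr => i _; rewrite /= W mulrA.
Qed.

(** Once the head [a] is treated as a suspended letter, as the Connes operator does, the parity
    change from |a| to |a| - 1 turns all signs into bar signs, and the last term becomes the cyclic
    product. *)
Lemma sum_hochschild_d_cons a s h :
  \sum_(c <- hochschild_d (a, s)) c.1 * h (c.2.1 :: c.2.2) =
  bar_d (a :: s) h - wrap (a :: s) h.
Proof.
rewrite (sum_hochschild_d a s (fun w => h (w.1 :: w.2))) /= -[bar_d s _ - _]opprB.
have -> : sg a = - sgn (hdeg a) by rewrite ksgnB ksgn1 mulrN1.
rewrite mulNr mulrN opprK -addrA; case: s => [|x t] /=.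
  by ring.
have -> : wdeg (a, belast x t) = 1 + sdeg (a :: belast x t).
  by rewrite sdeg_cons /wdeg /=; ring.
by ring.
Qed.

Lemma adif_hone : adif (aone A) = 0.
Proof.
have := adif_leibniz one one (0 + 1).
rewrite amul1 amul1 a1mul expr0z scale1r comp_Tagged => /eqP.
by rewrite -subr_eq0 opprD addrA subrr sub0r oppr_eq0 => /eqP.
Qed.

Lemma sum_hochschild_d_hone t (phi : word A -> k) :
  (forall s, phi (da one, s) = 0) -> t != [::] ->
  \sum_(c <- hochschild_d (one, t)) c.1 * phi c.2 =
  - bar_d t (fun l => phi (one, l))
  + rotation_defect t (fun l => if l is x :: s then phi (x, s) else 0).
Proof.
move=> phi0; case: t => [|x t] // _; rewrite sum_hochschild_d phi0 /= sub0r.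
rewrite /hdeg /= ksgn0 !mul1r a1mul amul1; congr (_ + (_ - ksgn _ * _)).
by rewrite /wdeg /= /hdeg /= add0r.
Qed.

(** By [rotations_bar_d] the first sum is the rotations of [bar_d]. In the second, the differential
    of a word with unit head is minus [bar_d] plus the rotation defect, so only rotations of the
    defect remain, and these cancel. *)
Lemma hochschild_connes_anticomm (w : word A) (phi : word A -> k) :
  (forall s, phi (da one, s) = 0) ->
  \sum_(c <- hochschild_d w) c.1 * (\sum_(c' <- connes_B c.2) c'.1 * phi c'.2)
  + \sum_(c <- connes_B w) c.1 * (\sum_(c' <- hochschild_d c.2) c'.1 * phi c'.2)
  = 0.
Proof.
case: w => a s phi0.
under eq_bigr do rewrite sum_connes_B.
rewrite (sum_hochschild_d_cons a s (fun t => rotations t (fun l => phi (one, l)))).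
rewrite -rotations_bar_d.
rewrite (sum_connes_B _ (fun w => \sum_(c' <- hochschild_d w) c'.1 * phi c'.2)) /=.
rewrite -[RHS](rotations_defect (a :: s) (fun l => if l is x :: s then phi (x, s) else 0)).
rewrite /rotations -splitsD; apply: eq_splits => -[|x u] v _; first by rewrite addr0.
rewrite sum_hochschild_d_hone //; last by case: (v).
by rewrite -mulrDr addNKr.
Qed.

End BarConstruction.

(** * The dual Connes operator on normalized cochains *)

Section ConnesOperator.
Context {k : fieldType} (A : augDGA k).

Local Notation one := (hone A).
Implicit Types (s t u v : seq (homog A)) (phi : word A -> k^o).

Lemma eq_sdeg s t : map (@hdeg k A) s = map (@hdeg k A) t -> sdeg s = sdeg t.
Proof.
move=> E; have F u : sdeg u = \sum_(d <- map (@hdeg k A) u) (d - 1) by rewrite big_map.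
by rewrite !F E.
Qed.

(** A slot is carried to a slot that does not depend on the letter filling it, so linearity in a
    letter and vanishing on units survive rotation. The cases are a cut before, at and after the
    slot. *)
Lemma rot_slot (T : Type) (l r : seq T) i :
  exists l' r', forall x, rot i (l ++ x :: r) = l' ++ x :: r'.
Proof.
case: (ltnP i (size l)) => Hi.
  exists (drop i l), (r ++ take i l) => x.
  by rewrite /rot drop_cat take_cat Hi -catA.
case E: (i - size l)%N => [|j].
  exists [::], (r ++ l) => x.
  by rewrite /rot drop_cat take_cat ltnNge Hi E /= cats0.
exists (drop j r ++ l), (take j r) => x.
by rewrite /rot drop_cat take_cat ltnNge Hi E /= -catA.
Qed.

Lemma cochain_rot_unit n phi a u v i :
  is_cochain n phi -> phi (a, rot i (u ++ one :: v)) = 0.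
Proof. by move=> C; have [u' [v' ->]] := rot_slot u v i; exact: cochain_unit C _ _ _. Qed.

(** Stated for any slot of the full word, head included, so that an empty [u] gives linearity in the
    head and a nonempty one linearity in the other letters. *)
Lemma cochain_connes_linear n phi p (c : k) (x y : A p) u v :
  is_cochain n phi ->
  let B t := \sum_(i <- iota 1 (size t))
    ksgn (sdeg (take i t) * sdeg (drop i t)) * phi (one, rot i t) in
  B (u ++ Tagged (agr A) (c *: x + y) :: v) =
  c * B (u ++ Tagged (agr A) x :: v) + B (u ++ Tagged (agr A) y :: v).
Proof.
move=> C B; rewrite /B !size_cat /= big_distrr -big_split; apply: eq_bigr => i _ /=.
have [u' [v' E]] := rot_slot u v i; rewrite !E (cochain_tail C).
have D z z' : hdeg z = hdeg z' ->
    sdeg (take i (u ++ z :: v)) * sdeg (drop i (u ++ z :: v)) =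
    sdeg (take i (u ++ z' :: v)) * sdeg (drop i (u ++ z' :: v)).
  by move=> zz'; congr (_ * _); apply: eq_sdeg;
    rewrite ?map_take ?map_drop !map_cat /= zz'.
rewrite (D _ (Tagged (agr A) x)) // (D (Tagged (agr A) y) (Tagged (agr A) x)) //.
by rewrite mulrDr mulrCA.
Qed.

Lemma B_dual_cochain n phi : is_cochain n phi -> is_cochain (n + 1) (B_dual n phi).
Proof.
have BE w : B_dual n phi w = ksgn n * \sum_(i <- iota 1 (size (w.1 :: w.2)))
    ksgn (sdeg (take i (w.1 :: w.2)) * sdeg (drop i (w.1 :: w.2)))
    * phi (one, rot i (w.1 :: w.2)).
  by rewrite /B_dual /dual_op /connes_B big_map.
move=> C; split.
- move=> p c x y s; rewrite !BE mulrCA -mulrDr; congr (_ * _).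
  exact: (cochain_connes_linear c x y [::] s C).
- move=> p c x y a s t; rewrite !BE mulrCA -mulrDr; congr (_ * _).
  exact: (cochain_connes_linear c x y (a :: s) t C).
- move=> a s t; rewrite BE big1 ?mulr0 // => i _.
  by rewrite (cochain_rot_unit _ (a :: s)  _ _ C) mulr0.
- move=> w wn; rewrite BE big1 ?mulr0 // => i _.
  rewrite (cochain_deg C) ?mulr0 //; apply: contra wn => /eqP <-.
  rewrite /wdeg /= (_ : sdeg (rot _ _) = sdeg (w.1 :: w.2)).
    by rewrite sdeg_cons {1}/hdeg /=; apply/eqP; ring.
  by rewrite /rot sdeg_cat addrC -sdeg_cat cat_take_drop.
Qed.

(** Rotation moves the unit head into a bar slot, where normalized cochains vanish. Since [connes_B]
    only produces unit heads, its dual squares to zero. *)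
Lemma B_dual_unit n p phi s : is_cochain p phi -> B_dual n phi (one, s) = 0.
Proof.
move=> C; rewrite /B_dual /dual_op /connes_B big_map big1 ?mulr0 // => i _.
by rewrite (cochain_rot_unit _ [::] _ _ C) mulr0.
Qed.

Lemma B_dual_square m n p phi : is_cochain p phi -> B_dual m (B_dual n phi) = 0.
Proof.
move=> C; apply/funext => w.
rewrite {1}/B_dual /dual_op /connes_B big_map big1 ?mulr0 // => i _.
by rewrite (B_dual_unit _ _ C) mulr0.
Qed.

Lemma dual_op_dual (T U : word A -> chain A) (m n : int) phi w :
  dual_op T m (dual_op U n phi) w = ksgn m * ksgn n *
    \sum_(c <- T w) c.1 * \sum_(c' <- U c.2) c'.1 * phi c'.2.
Proof.
rewrite {1}/dual_op -mulrA; congr (_ * _); rewrite big_distrr.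
by apply: eq_bigr => c _; rewrite mulrCA.
Qed.

Lemma d_dual_B_dual (l m n p : int) phi :
  is_cochain p phi -> m = n + 1 -> n = l + 1 ->
  d_dual m (B_dual n phi) = - B_dual l (d_dual n phi).
Proof.
move=> C -> ->; apply/funext => w.
have phi0 s : phi (hmap (@adif k A) one, s) = 0.
  (* Linearity with scalar -1 at zero vectors shows that [phi] vanishes on a zero head, here the
     differential of the unit. *)
  have := cochain_head C (-1) (0 : A (0 + 1)) 0 s.
  by rewrite scaler0 addr0 mulN1r addNr -adif_hone.
have /eqP := hochschild_connes_anticomm w phi0.
rewrite addr_eq0 => /eqP E.
rewrite (_ : (- _) w = - B_dual l (d_dual (l + 1) phi) w) // /d_dual /B_dual !dual_op_dual E.
by rewrite (ksgn_eq (m := l + 1 + 1) (n := l) (c := 1)) ?mulrN //; ring.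
Qed.

End ConnesOperator.

(** * The Connes exact sequences *)

Section Representatives.
Context {k : fieldType} (X : precomplex k) (n : int).
Implicit Types (x y : X) (c d : coh X n).

Lemma represents_linear a x y c d :
  represents x c -> represents y d -> represents (a *: x + y) (a *: c + d).
Proof.
move=> [z <- <-] [w <- <-]; exists (a *: z + w); first by rewrite linearP.
by rewrite raddfD /= pi_coh_scale.
Qed.

Lemma represents_exists c : exists x, represents x c.
Proof. by exists (val (repr c)); exists (repr c) => //; rewrite reprK. Qed.

Lemma represents_cocycle x c : represents x c -> cdeg n x /\ cdiff n x = 0.
Proof. by move=> [[y yP] /= <- _]; apply/asboolP. Qed.

Lemma cocycle_represents x :
  cdeg n x -> cdiff n x = 0 -> exists c, represents x c.
Proof.
move=> xn dx; have xC : x \in cocycle n by apply/asboolP.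
by eexists; exists (Cocycle xC).
Qed.

Lemma represents_inj x c d : represents x c -> represents x d -> c = d.
Proof. by move=> [z <- <-] [w /val_inj -> <-]. Qed.

Lemma represents_eq0 x c :
  represents x c -> c = 0 <-> exists2 u, cdeg (n + 1) u & cdiff (n + 1) u = x.
Proof.
move=> [z <- <-]; have E : (\pi_(cohomology X n) z == 0)%qT = (z \in coboundary (n := n)).
  by rewrite -[z in RHS]subr0 Quotient.idealrBE raddf0.
by split=> [/eqP|[u un du]]; [|apply/eqP]; rewrite E; [move/asboolP|apply/asboolP; exists u].
Qed.

Lemma represents0 : represents (0 : X) (0 : coh X n).
Proof.
have [c xc] := cocycle_represents (cdeg0 X n) (cdiff0 X n).
suff <- : c = 0 by [].
by apply/(represents_eq0 xc); exists 0; [exact: cdeg0 | exact: cdiff0].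
Qed.

End Representatives.

(** A total linear relation in which 0 is related only to 0 is the graph of a linear map.
    Well-definedness and linearity of induced and connecting maps both come from this. *)
Lemma xget_linear (k : fieldType) (C D : lmodType k) (R : C -> D -> Prop) :
  (forall c, exists d, R c d) ->
  (forall a c c' d d', R c d -> R c' d' -> R (a *: c + c') (a *: d + d')) ->
  (forall d, R 0 d -> d = 0) ->
  linear (fun c => xget 0 [set d | R c d]%classic) /\
  forall c d, R c d -> xget 0 [set d | R c d]%classic = d.
Proof.
move=> tot lin zero; set f := fun c => xget _ _.
have fP c : R c (f c) by have [d Rd] := tot c; exact: (xgetPex 0 (ex_intro _ d Rd)).
have uniq c d d' : R c d -> R c d' -> d = d'.
  move=> Rd Rd'; apply/eqP; rewrite eq_sym -subr_eq0 addrC -scaleN1r; apply/eqP.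
  by apply: zero; rewrite -[0](addNr c) -scaleN1r; apply: lin.
split=> [a c c'|c d Rd]; last exact: uniq (fP c) Rd.
by apply: uniq (fP _) _; apply: lin.
Qed.

Section InducedMap.
Context {k : fieldType} (X Y : precomplex k) (f : X -> Y) (p q : int).
Hypothesis f_linear : linear f.
Hypothesis f_cocycle :
  forall x, cdeg p x -> cdiff p x = 0 -> cdeg q (f x) /\ cdiff q (f x) = 0.
Hypothesis f_coboundary : forall u, cdeg (p + 1) u ->
  exists2 u', cdeg (q + 1) u' & cdiff (q + 1) u' = f (cdiff (p + 1) u).

Let induced_rel (c : coh X p) (c' : coh Y q) :=
  exists2 x, represents x c & represents (f x) c'.

Lemma induced_spec : linear (@induced k X Y f p q) /\
  forall x c, represents x c -> represents (f x) (@induced k X Y f p q c).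
Proof.
have [|||L U] := @xget_linear k _ _ induced_rel.
- move=> c; have [x xc] := represents_exists c.
  have [xp dx] := represents_cocycle xc; have [fxq dfx] := f_cocycle xp dx.
  by have [c' xc'] := cocycle_represents fxq dfx; exists c'; exists x.
- move=> a c c' d d' [x xc xd] [x' xc' xd']; exists (a *: x + x').
    exact: represents_linear.
  by rewrite f_linear; exact: represents_linear.
- move=> d [x x0 xd]; have [u up du] := (represents_eq0 x0).1 erefl.
  by apply/(represents_eq0 xd); rewrite -du; exact: f_coboundary.
split=> // x c xc; have [xp dx] := represents_cocycle xc.
have [fxq dfx] := f_cocycle xp dx.
have [c' xc'] := cocycle_represents fxq dfx.
by rewrite /induced (U c c') //; exists x.
Qed.

End InducedMap.

Section ConnectingMap.
Context {k : fieldType} (X Y Z : precomplex k).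
Context (f : X -> Y) (g : Y -> Z) (p r q : int).
Hypothesis f_linear : linear f.
Hypothesis g_linear : linear g.
Hypothesis lift : forall z, cdeg p z -> cdiff p z = 0 -> exists y x,
  [/\ cdeg r y, g y = z, cdiff r y = f x, cdeg q x & cdiff q x = 0].
Hypothesis lift_coboundary : forall y x u, cdeg r y -> cdeg (p + 1) u ->
  cdiff (p + 1) u = g y -> cdiff r y = f x ->
  exists2 v, cdeg (q + 1) v & cdiff (q + 1) v = x.

Let connecting_rel (c : coh Z p) (c' : coh X q) := exists y x,
  [/\ cdeg r y, represents (g y) c, cdiff r y = f x & represents x c'].

(** Totality of the relation is [lift]; independence of the choices is [lift_coboundary]. *)
Lemma connecting_spec : linear (@connecting k X Y Z f g p r q) /\
  forall y x c, cdeg r y -> represents (g y) c -> cdiff r y = f x ->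
    cdeg q x -> cdiff q x = 0 ->
    represents x (@connecting k X Y Z f g p r q c).
Proof.
have [|||L U] := @xget_linear k _ _ connecting_rel.
- move=> c; have [z zc] := represents_exists c.
  have [zp dz] := represents_cocycle zc.
  have [y [x [yr gy dy xq dx]]] := lift zp dz.
  have [c' xc'] := cocycle_represents xq dx.
  by exists c', y, x; rewrite gy.
- move=> a c c' d d' [y [x [yr gy dy xd]]] [y' [x' [yr' gy' dy' xd']]].
  exists (a *: y + y'), (a *: x + x'); split.
  + exact: cdegP.
  + by rewrite g_linear; exact: represents_linear.
  + by rewrite cdiffP dy dy' f_linear.
  + exact: represents_linear.
- move=> d [y [x [yr gy dy xd]]]; have [u up du] := (represents_eq0 gy).1 erefl.
  by apply/(represents_eq0 xd); exact: lift_coboundary yr up du dy.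
split=> // y x c yr gy dy xq dx.
have [c' xc'] := cocycle_represents xq dx.
by rewrite /connecting (U c c') //; exists y, x.
Qed.

End ConnectingMap.

(** * The maps b and i on cochains, and their two composites *)

Section ConnesMaps.
Context {k : fieldType} (A : augDGA k).

Local Notation coeffs := (nat -> word A -> k^o).
Implicit Types (phi : word A -> k^o) (x y : coeffs).

Lemma dual_op0 (T : word A -> chain A) n : dual_op T n 0 = 0.
Proof.
by apply/funext => w; rewrite /dual_op big1 ?mulr0 // => c _; rewrite mulr0.
Qed.

Lemma dual_opD (T : word A -> chain A) n phi psi :
  dual_op T n (phi + psi) = dual_op T n phi + dual_op T n psi.
Proof. by rewrite -[phi in LHS]scale1r dual_op_linear scale1r. Qed.

Lemma dual_opB (T : word A -> chain A) n phi psi :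
  dual_op T n (phi - psi) = dual_op T n phi - dual_op T n psi.
Proof.
by rewrite addrC -scaleN1r dual_op_linear scaleN1r addrC.
Qed.

Lemma dual_opN (T : word A -> chain A) n phi :
  dual_op T n (- phi) = - dual_op T n phi.
Proof. by rewrite -sub0r dual_opB dual_op0 sub0r. Qed.

Lemma is_cochainB n phi psi :
  is_cochain n phi -> is_cochain n psi -> is_cochain n (phi - psi).
Proof. by rewrite addrC -scaleN1r => ? ?; apply: is_cochainP. Qed.

Lemma cyclic_diff0 n x : cyclic_diff n x 0%N = d_dual n (x 0%N).
Proof.
transitivity (d_dual (n + (0%N).*2%:Z) (x 0%N) + 0) => //.
by rewrite !addr0.
Qed.

Lemma cyclic_diffS n x j : cyclic_diff n x j.+1 =
  d_dual (n + j.*2%:Z + 2) (x j.+1) + B_dual (n + j.*2%:Z) (x j).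
Proof.
transitivity (d_dual (n + (j.+1).*2%:Z) (x j.+1) + B_dual (n + j.*2%:Z) (x j)) => //.
by rewrite doubleS -addn2 PoszD addrA.
Qed.

Lemma neg_cyclic_diffE n x j : neg_cyclic_diff n x j =
  d_dual (n - j.*2%:Z) (x j) + B_dual (n - j.*2%:Z - 2) (x j.+1).
Proof.
transitivity (d_dual (n - j.*2%:Z) (x j) + B_dual (n - (j.+1).*2%:Z) (x j.+1)) => //.
by rewrite doubleS -addn2 PoszD opprD addrA.
Qed.

Lemma at_v0_linear : linear (@at_v0 k A).
Proof. by []. Qed.

Lemma in_v0_linear : linear (@in_v0 k A).
Proof.
move=> a phi psi; apply/funext => -[|j] //.
transitivity (a *: 0 + 0 : word A -> k^o) => //.
by rewrite scaler0 addr0.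
Qed.

Lemma mulv_pos_linear : linear (@mulv_pos k A).
Proof.
move=> a x y; apply/funext => -[|j] //.
transitivity (a *: 0 + 0 : word A -> k^o) => //.
by rewrite scaler0 addr0.
Qed.

Lemma mulv_neg_linear : linear (@mulv_neg k A).
Proof. by []. Qed.

Lemma in_v0_cyclic n phi : is_cochain n phi -> is_cyclic_cochain n (in_v0 phi).
Proof.
move=> C; split; last by exists 1%N => -[].
by case=> [|j]; [rewrite addr0 | exact: is_cochain0].
Qed.

Lemma in_v0_neg_cyclic n phi : is_cochain n phi -> is_neg_cyclic_cochain n (in_v0 phi).
Proof. by move=> C [|j]; [rewrite subr0 | exact: is_cochain0]. Qed.

Lemma cyclic_diff_in_v0 n phi :
  d_dual n phi = 0 -> cyclic_diff n (in_v0 phi) = mulv_pos (in_v0 (B_dual n phi)).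
Proof.
move=> dphi; apply/funext => -[|[|j]]; first by rewrite cyclic_diff0.
- by rewrite cyclic_diffS /d_dual dual_op0 add0r addr0.
- by rewrite cyclic_diffS /d_dual /B_dual !dual_op0 addr0.
Qed.

Lemma neg_cyclic_diff_in_v0 n phi :
  neg_cyclic_diff n (in_v0 phi) = in_v0 (d_dual n phi).
Proof.
by apply/funext => -[|j]; rewrite neg_cyclic_diffE /d_dual /B_dual !dual_op0 ?addr0 ?subr0.
Qed.

Lemma d_dual_B_dual_cocycle n phi :
  is_cochain n phi -> d_dual n phi = 0 -> d_dual (n + 1) (B_dual n phi) = 0.
Proof.
move=> C dphi; rewrite (@d_dual_B_dual _ _ (n - 1) _ _ _ _ C) ?subrK //.
by rewrite dphi /B_dual dual_op0 oppr0.
Qed.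

Lemma hc_b_spec n : linear (@hc_b k A n) /\
  forall (x : cyclic_cx A) (c : HC A n), represents x c ->
    represents (x 0%N : hochschild_cx A) (hc_b c).
Proof.
apply: induced_spec; first exact: at_v0_linear.
  move=> x [xn _] /(congr1 (fun y => y 0%N)) /= dx.
  by split; [have := xn 0%N; rewrite addr0 | rewrite -cyclic_diff0].
move=> u [un _]; exists (u 0%N); first by have := un 0%N; rewrite addr0.
by rewrite /= /at_v0 cyclic_diff0.
Qed.

Lemma hc_i_spec n : linear (@hc_i k A n) /\
  forall (y x : cyclic_cx A) (c : HH A n), cdeg n y ->
    represents (y 0%N : hochschild_cx A) c -> cdiff n y = mulv_pos x ->
    cdeg (n + 1) x -> cdiff (n + 1) x = 0 -> represents x (hc_i c).
Proof.
apply: connecting_spec; first exact: mulv_pos_linear.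
- exact: at_v0_linear.
- move=> phi /= C dphi; exists (in_v0 phi), (in_v0 (B_dual n phi)); split => //.
  + exact: in_v0_cyclic.
  + exact: cyclic_diff_in_v0.
  + exact/in_v0_cyclic/B_dual_cochain.
  + rewrite cyclic_diff_in_v0 ?d_dual_B_dual_cocycle // (B_dual_square _ _ C).
    by apply/funext => -[|[|j]].
move=> y x u /= [yn [N yN]] un du dy.
have x_ j : x j = cyclic_diff n y j.+1 by rewrite dy.
(* Here y_0 = d u, so y - (d + vB) u has no v^0 term. Dividing it by v gives the witness, whose
   differential is x because that of y is v x. *)
exists (fun j => y j.+1 - in_v0 (B_dual (n + 1) u) j).
  split=> [j|]; last first.
    exists (maxn N 1) => -[|j]; first by rewrite geq_max ltn0 andbF.
    by rewrite geq_max => /andP[Nj _]; rewrite yN ?subrr // (leq_trans Nj) // ltnW.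
  apply: is_cochainB.
    by have := yn j.+1; rewrite doubleS -addn2 PoszD; congr is_cochain; ring.
  by have [+ _] := in_v0_cyclic (B_dual_cochain un); apply.
apply/funext => -[|j].
  rewrite cyclic_diff0 x_ cyclic_diffS /= /d_dual dual_opB -!/(d_dual _ _).
  by rewrite (@d_dual_B_dual _ _ n _ _ _ _ un) // opprK du /at_v0 addr0 -addrA.
rewrite cyclic_diffS !x_ cyclic_diffS subr0 /B_dual dual_opB -!/(B_dual _ _).
have -> : B_dual (n + 1 + 1 + j.*2%:Z) (in_v0 (B_dual (n + 1) u) j) = 0.
  by case: j => [|j]; [exact: B_dual_square un | exact: dual_op0].
have -> : n + 1 + 1 + j.*2%:Z = n + j.+1.*2%:Z by rewrite doubleS -(addn2 j.*2) PoszD; ring.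
by rewrite subr0.
Qed.

Lemma hcneg_i_spec n : linear (@hcneg_i k A n) /\
  forall (phi : hochschild_cx A) (c : HH A n), represents phi c ->
    represents (in_v0 phi : neg_cyclic_cx A) (hcneg_i c).
Proof.
apply: induced_spec; first exact: in_v0_linear.
  move=> phi /= C dphi; split; first exact: in_v0_neg_cyclic.
  by rewrite neg_cyclic_diff_in_v0 dphi; apply/funext => -[].
move=> u un; exists (in_v0 u); first exact: in_v0_neg_cyclic.
exact: neg_cyclic_diff_in_v0.
Qed.

Lemma neg_degree_shift (n : int) j : n + 2 - j.+1.*2%:Z = n - j.*2%:Z.
Proof. by rewrite doubleS -(addn2 j.*2) PoszD; ring. Qed.

(** With coefficients indexed by powers of v^{-1}, the shift [mulv_pos] is multiplication by v^{-1},
    of degree 2. It provides lifts along [mulv_neg]. *)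
Lemma mulv_pos_neg_cyclic n x :
  is_neg_cyclic_cochain n x -> is_neg_cyclic_cochain (n + 2) (mulv_pos x).
Proof.
by move=> xn [|j]; [exact: is_cochain0 | rewrite neg_degree_shift; exact: xn].
Qed.

(** The term v B x_0, zero modulo v k[v], becomes B x_0 at v^0 after multiplication by v^{-1}; the
    other coefficients are those of the differential of [x]. *)
Lemma neg_cyclic_diff_mulv_pos n x : neg_cyclic_diff n x = 0 ->
  neg_cyclic_diff (n + 2) (mulv_pos x) = in_v0 (B_dual n (x 0%N)).
Proof.
move=> dx; apply/funext => -[|j].
  by rewrite neg_cyclic_diffE /d_dual dual_op0 add0r subr0 addrK.
transitivity (neg_cyclic_diff n x j); last by rewrite dx.
by rewrite !neg_cyclic_diffE neg_degree_shift.
Qed.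

(** At v^0 the cocycle condition reads d x_0 = - B x_1, whence d B x_0 = - B d x_0 = B B x_1 = 0. *)
Lemma B_dual_neg_cocycle n x : is_neg_cyclic_cochain n x ->
  neg_cyclic_diff n x = 0 ->
  is_cochain (n + 1) (B_dual n (x 0%N)) /\ d_dual (n + 1) (B_dual n (x 0%N)) = 0.
Proof.
move=> xn dx; have x0 : is_cochain n (x 0%N) by have := xn 0%N; rewrite subr0.
split; first exact: B_dual_cochain.
rewrite (@d_dual_B_dual _ _ (n - 1) _ _ _ _ x0) ?subrK //.
have /eqP := congr1 (fun y => y 0%N) dx; rewrite neg_cyclic_diffE subr0.
rewrite addr_eq0 => /eqP ->.
by rewrite [B_dual _ (- _)]dual_opN opprK; exact: B_dual_square (xn 1%N).
Qed.

Lemma hcneg_b_spec n : linear (@hcneg_b k A n) /\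
  forall (x : neg_cyclic_cx A) (c : HCneg A n), represents x c ->
    represents (B_dual n (x 0%N) : hochschild_cx A) (hcneg_b c).
Proof.
have [||||L S] := @connecting_spec k (hochschild_cx A) (neg_cyclic_cx A)
    (neg_cyclic_cx A) (@in_v0 k A) (@mulv_neg k A) n (n + 2) (n + 1).
- exact: in_v0_linear.
- exact: mulv_neg_linear.
- move=> x /= xn dx; exists (mulv_pos x), (B_dual n (x 0%N)).
  have [Bn dB] := B_dual_neg_cocycle xn dx; split=> //.
    exact: mulv_pos_neg_cyclic.
  exact: neg_cyclic_diff_mulv_pos.
- move=> y x u /= yn un du dy.
  have u0 : is_cochain (n + 1) (u 0%N) by have := un 0%N; rewrite subr0.
  (* As [u] bounds [mulv_neg y], y_1 = d u_0 + B u_1. Hence x = d y_0 + B y_1 = d y_0 + B d u_0 = d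
     (y_0 - B u_0). *)
  exists (y 0%N - B_dual (n + 1) (u 0%N)).
    apply: is_cochainB; last exact: B_dual_cochain.
    by have := yn 0%N; rewrite subr0 -addrA.
  rewrite /d_dual dual_opB -!/(d_dual _ _).
  rewrite (@d_dual_B_dual _ _ n _ _ _ _ u0) // opprK.
  have -> : x = neg_cyclic_diff (n + 2) y 0%N by rewrite dy.
  rewrite neg_cyclic_diffE subr0 addrK.
  rewrite (_ : y 1%N = neg_cyclic_diff (n + 1) u 0%N); last by rewrite du.
  rewrite neg_cyclic_diffE subr0 -addrA; congr (_ + _).
  by rewrite [RHS]dual_opD -!/(B_dual _ _) (B_dual_square _ _ (un 1%N)) addr0.
split=> // x c xc; have [xn dx] := represents_cocycle xc.
have [Bn dB] := B_dual_neg_cocycle xn dx.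
apply: (S (mulv_pos x)) => //; first exact: mulv_pos_neg_cyclic.
exact: neg_cyclic_diff_mulv_pos.
Qed.

(** A cyclic cocycle is itself a lift of its v^0 coefficient, and its differential is v times 0. *)
Lemma hc_i_b n (c : HC A n) : hc_i (hc_b c) = 0.
Proof.
have [x xc] := represents_exists c; have [xn dx] := represents_cocycle xc.
have [_ /(_ x c xc) bc] := hc_b_spec n.
have [_ /(_ x 0 _ xn bc) ib] := hc_i_spec n.
apply: (represents_inj (ib _ _ _)); last exact: represents0.
- by rewrite dx; apply/funext => -[].
- exact: cdeg0.
- exact: cdiff0.
Qed.

(** The cochain v^{-1} x bounds the representative B x_0 of the image. *)
Lemma hcneg_i_b n (c : HCneg A n) : hcneg_i (hcneg_b c) = 0.
Proof.
have [x xc] := represents_exists c; have [xn dx] := represents_cocycle xc.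
have [_ /(_ x c xc) bc] := hcneg_b_spec n.
have [_ /(_ _ _ bc) ib] := hcneg_i_spec (n + 1).
apply/(represents_eq0 ib); exists (mulv_pos x); rewrite -addrA.
  exact: mulv_pos_neg_cyclic.
exact: neg_cyclic_diff_mulv_pos.
Qed.

Lemma hcneg_b_i n (c : HH A n) : hcneg_b (hcneg_i c) = bv_delta c.
Proof.
have [phi phic] := represents_exists c; have [C dphi] := represents_cocycle phic.
have [_ /(_ _ _ phic) ic] := hcneg_i_spec n.
have [_ /(_ _ _ ic) bic] := hcneg_b_spec n.
apply: (represents_inj bic).
have [_ /(_ (in_v0 phi) (in_v0 (B_dual n phi)) c) i'c] := hc_i_spec n.
have [_ H] := hc_b_spec (n + 1); apply: (H (in_v0 (B_dual n phi))); apply: i'c => //.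
- exact: in_v0_cyclic.
- exact: cyclic_diff_in_v0.
- exact/in_v0_cyclic/B_dual_cochain.
- rewrite /= cyclic_diff_in_v0 ?d_dual_B_dual_cocycle // (B_dual_square _ _ C).
  by apply/funext => -[|[|j]].
Qed.

End ConnesMaps.

(** * Gravity algebras from BV-algebras *)

Section HomogeneousLinear.
Context {k : fieldType}.
Implicit Types (V W : int -> lmodType k) (U : lmodType k).

Definition hlinear V U (G : homog V -> U) : Prop :=
  forall p, linear (fun x : V p => G (Tagged V x)).

Lemma hlinear0 V U (G : homog V -> U) (x : homog V) :
  hlinear G -> tagged x = 0 -> G x = 0.
Proof.
case: x => p x HG /= ->; have := HG p (-1) 0 0.
by rewrite scaler0 addr0 scaleN1r addNr.
Qed.

Lemma hlinear_comp V n : hlinear (@comp k V n).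
Proof.
move=> p a x y; case: (eqVneq p n) => [<-|pn]; first by rewrite !comp_Tagged.
by rewrite /comp !untag_dflt // scaler0 addr0.
Qed.

Lemma hlinear_hmap V W U (G : homog W -> U) (r : int -> int)
    (f : forall n, V n -> W (r n)) :
  hlinear G -> (forall n, linear (f n)) -> hlinear (fun x => G (hmap f x)).
Proof. by move=> HG fl p a x y; rewrite /hmap /= fl; apply: HG. Qed.

(** Carries an identity between components inside a larger expression [G], without casts between
    equal degrees. The condition on degrees ensures that [comp] loses no term. *)
Lemma hlinear_transport V U (G : homog V -> U) (x : homog V)
    (L : seq (k * homog V)) :
  hlinear G -> {in L, forall c, hdeg c.2 = hdeg x} ->
  comp (hdeg x) x = \sum_(c <- L) c.1 *: comp (hdeg x) c.2 ->
  G x = \sum_(c <- L) c.1 *: G c.2.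
Proof.
move=> HG DL E; rewrite -[in LHS](Tagged_comp (erefl (hdeg x))) E.
elim: L DL {E} => [|c L IH] DL; first by rewrite !big_nil (hlinear0 HG).
rewrite !big_cons HG Tagged_comp ?DL ?mem_head // IH // => c' c'L.
by apply: DL; rewrite inE c'L orbT.
Qed.

Section Product.
Context V (m : forall p q, V p -> V q -> V (p + q)) (m_bilinear : bilinear_product m).
Local Notation mul := (hmul m).

Lemma hlinear_mull U (G : homog V -> U) x : hlinear G -> hlinear (fun z => G (mul x z)).
Proof. by move=> HG p a y z; rewrite /hmul /= (m_bilinear.2 _ _ _ a); apply: HG. Qed.

Lemma hlinear_mulr U (G : homog V -> U) x : hlinear G -> hlinear (fun z => G (mul z x)).
Proof. by move=> HG p a y z; rewrite /hmul /= (m_bilinear.1 _ _ _ a); apply: HG. Qed.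

Lemma hlinear_foldl U (G : homog V -> U) s :
  hlinear G -> hlinear (fun z => G (foldl mul z s)).
Proof. by move=> HG; elim: s => //= x s; apply: hlinear_mulr. Qed.

Lemma hdeg_foldl x s : hdeg (foldl mul x s) = \sum_(y <- x :: s) hdeg y.
Proof.
elim/last_ind: s => [|s y IH]; first by rewrite big_seq1.
by rewrite foldl_rcons -rcons_cons big_rcons /= -IH addrC.
Qed.

End Product.
End HomogeneousLinear.

Section Omission.
Variables (T : Type) (x0 : T).
Implicit Types (w : seq T).

(** Generalizes [omit2]: the induction on products also omits a single position. *)
Definition positions (P : pred nat) w := [seq nth x0 w r | r <- iota 0 (size w) & P r].

Lemma positions_rcons P w x : positions P (rcons w x) =
  if P (size w) then rcons (positions P w) x else positions P w.
Proof.
rewrite /positions size_rcons -addn1 iotaD filter_cat map_cat /= add0n.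
have -> : [seq nth x0 (rcons w x) r | r <- iota 0 (size w) & P r] =
          [seq nth x0 w r | r <- iota 0 (size w) & P r].
  apply/eq_in_map => r; rewrite mem_filter mem_iota => /andP[_ /= rw].
  by rewrite nth_rcons rw.
by case: (P _); rewrite ?cats0 //= nth_rcons ltnn eqxx cats1.
Qed.

Lemma eq_positions P Q w : {in gtn (size w), P =1 Q} -> positions P w = positions Q w.
Proof.
move=> PQ; rewrite /positions; congr map; apply: eq_in_filter => r.
by rewrite mem_iota add0n => /= rw; apply: PQ.
Qed.

Lemma positionsT (P : pred nat) w : {in gtn (size w), forall r, P r} -> positions P w = w.
Proof.
move=> PT; rewrite (eq_positions (Q := predT)); last by move=> r /PT.
by rewrite /positions filter_predT map_nth_iota0 // take_size.
Qed.

End Omission.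

Lemma map_positions (T T' : Type) (f : T -> T') x0 P w :
  map f (positions x0 P w) = positions (f x0) P (map f w).
Proof.
rewrite /positions size_map -map_comp; apply/eq_in_map => r.
by rewrite mem_filter mem_iota => /andP[_ /= rw]; rewrite (nth_map x0).
Qed.

(** * Gravity signs when a letter is appended *)

Section GravitySigns.
Context {k : fieldType}.
Local Notation gsgn := (@gravity_sign k).
Implicit Types (ds : seq int).

Lemma sum_nth_rcons ds d i (P : pred nat) : (i <= size ds)%N ->
  \sum_(0 <= r < i | P r) nth 0 (rcons ds d) r = \sum_(0 <= r < i | P r) nth 0 ds r.
Proof.
move=> ids; rewrite big_nat_cond [RHS]big_nat_cond; apply: eq_bigr => r.
by case/andP => /andP[_ ri] _; rewrite nth_rcons (leq_trans ri ids).
Qed.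

Lemma gravity_sign_rcons ds d i j : (i < size ds)%N -> (j < size ds)%N ->
  gsgn (rcons ds d) i j = gsgn ds i j.
Proof.
move=> ids jds; rewrite /gravity_sign !nth_rcons ids jds.
by rewrite !sum_nth_rcons // ltnW.
Qed.

Lemma nth_rcons_last ds d : nth 0 (rcons ds d) (size ds) = d.
Proof. by rewrite nth_rcons ltnn eqxx. Qed.

Lemma nth_rcons_lt ds d i : (i < size ds)%N -> nth 0 (rcons ds d) i = nth 0 ds i.
Proof. by move=> ids; rewrite nth_rcons ids. Qed.

Lemma gravity_sign_last ds e i : (i < size ds)%N ->
  gsgn (rcons ds e) i (size ds) =
  ksgn (nth 0 ds i * \sum_(0 <= r < i) nth 0 ds r
        + e * \sum_(0 <= r < size ds | r != i) nth 0 ds r).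
Proof.
move=> ids; rewrite /gravity_sign nth_rcons_last nth_rcons_lt //.
by rewrite !sum_nth_rcons // ltnW.
Qed.

(** With [d] inserted before it, the last letter [e] must also pass [d] on its way to the front. *)
Lemma gravity_sign_skip ds d e i : (i < size ds)%N ->
  gsgn (rcons (rcons ds d) e) i (size ds).+1 =
  ksgn (d * e) * gsgn (rcons ds e) i (size ds).
Proof.
move=> ids; have ids' : (i < size (rcons ds d))%N by rewrite size_rcons ltnW.
rewrite -(size_rcons ds d) (gravity_sign_last _ ids') (gravity_sign_last _ ids).
rewrite size_rcons nth_rcons_lt // sum_nth_rcons ?(ltnW ids) // -ksgnD; congr ksgn.
rewrite [\sum_(0 <= r < (size ds).+1 | _) _]big_mkcond big_nat_recr //= -big_mkcond.
rewrite sum_nth_rcons // nth_rcons_last eq_sym (ltn_eqF ids) /=; ring.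
Qed.

Lemma gravity_sign_last2 ds d e :
  gsgn (rcons (rcons ds d) e) (size ds) (size ds).+1 =
  ksgn ((\sum_(x <- ds) x) * (d + e)).
Proof.
rewrite -(size_rcons ds d) gravity_sign_last ?size_rcons // nth_rcons_last.
rewrite [\sum_(0 <= r < (size ds).+1 | _) _]big_mkcond big_nat_recr //= eqxx addr0.
rewrite -big_mkcond !sum_nth_rcons //.
rewrite [\sum_(x <- ds) x](big_nth 0).
rewrite [X in e * X](_ : _ = \sum_(0 <= r < size ds) nth 0 ds r); last first.
  rewrite big_nat_cond [RHS]big_nat_cond; apply: eq_bigl => r.
  by rewrite andbT; case: ltnP; rewrite ?andbF // => /ltn_eqF ->.
by congr ksgn; ring.
Qed.

End GravitySigns.

(** * The BV operator on products of closed elements *)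

Section SecondOrderOperator.
Context {k : fieldType} {V : int -> lmodType k}.
Context (cup : forall p q, V p -> V q -> V (p + q)) (Delta : forall n, V n -> V (n + 1)).
Hypothesis BV : is_BV_algebra cup Delta.

Local Notation mul := (hmul cup).
Local Notation D := (hmap Delta).
Local Notation prod := (foldl mul).
Local Notation closed := (fun x : homog V => tagged (D x) = 0).
Context {U : lmodType k}.
Implicit Types (G : homog V -> U) (a b c x : homog V) (l : seq (homog V)).

Let mulP := bv_bilinear BV.

Lemma bv_comm_apply G x y : hlinear G -> G (mul x y) = ksgn (hdeg x * hdeg y) *: G (mul y x).
Proof.
move=> HG; rewrite (hlinear_transport (x := mul x y)
  (L := [:: (ksgn (hdeg x * hdeg y), mul y x)]) HG) ?big_seq1 //; last exact: (bv_comm BV).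
by move=> c'; rewrite inE => /eqP ->; rewrite /hdeg /= addrC.
Qed.

Lemma bv_seven_closed G a b c : hlinear G -> closed b -> closed c ->
  G (D (mul (mul a b) c)) = G (mul (D (mul a b)) c)
    + ksgn (hdeg a) *: G (mul a (D (mul b c)))
    + ksgn ((hdeg a - 1) * hdeg b) *: G (mul b (D (mul a c)))
    - G (mul (mul (D a) b) c).
Proof.
move=> HG b0 c0.
rewrite (hlinear_transport (x := D (mul (mul a b) c)) (L := [:: (1, mul (D (mul a b)) c);
  (ksgn (hdeg a), mul a (D (mul b c)));
  (ksgn ((hdeg a - 1) * hdeg b), mul b (D (mul a c)));
  (-1, mul (mul (D a) b) c)]) HG).
- by rewrite !big_cons big_nil addr0 /= scale1r scaleN1r !addrA.
- by move=> e; rewrite !inE => /or4P[]/eqP ->; rewrite /hdeg /=; ring.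
have Zb n : comp n (mul (mul a (D b)) c) = 0.
  exact: (hlinear0 (hlinear_mull mulP _ (hlinear_mulr mulP _ (hlinear_comp _)))).
have Zc n : comp n (mul (mul a b) (D c)) = 0.
  exact: (hlinear0 (hlinear_mull mulP _ (hlinear_comp _))).
rewrite (bv_seven BV) Zb Zc !scaler0 !subr0 !big_cons big_nil addr0 /=.
by rewrite scale1r scaleN1r !addrA.
Qed.

Lemma mul_prod x a l : mul x (prod a l) = prod x (a :: l).
Proof. by elim: l a => //= b l IH a; rewrite IH /= (bv_assoc BV). Qed.

Local Notation degs := (map (@hdeg k V)).
Local Notation gsgn := (@gravity_sign k).

Lemma hdegD x : hdeg (D x) = hdeg x + 1. Proof. by []. Qed.
Lemma hdegM x y : hdeg (mul x y) = hdeg x + hdeg y. Proof. by []. Qed.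

(** Induction on [l], splitting off its last letter [b]: the seven-term identity for [prod a l],
    [b], [c] yields the pair of [b] and [c], and the induction hypothesis for the functional
    [G (mul z b)] of [z] yields the other pairs with [c]. *)
Lemma delta_prod_last x0 G a l c : hlinear G ->
  (forall x, x \in a :: l -> closed x) -> closed c ->
  G (D (mul (prod a l) c)) = G (mul (D (prod a l)) c)
    + \sum_(0 <= i < (size l).+1) gsgn (degs (rcons (a :: l) c)) i (size l).+1
      *: G (prod (D (mul (nth x0 (a :: l) i) c))
              (positions x0 (fun r => r != i) (a :: l))).
Proof.
move=> + + c0; elim/last_ind: l G => [|l b IH] G HG w0.
  rewrite big_nat1 /= (hlinear0 (hlinear_mulr mulP _ HG)) ?w0 ?mem_head //.
  rewrite add0r /positions /= /gravity_sign /= big_geq // big_mkcond big_nat1 /=.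
  by rewrite !mulr0 addr0 ksgn0 scale1r.
set P := prod a l in IH *.
have /IH {}IH x : x \in a :: l -> closed x.
  by move=> xl; apply: w0; rewrite -rcons_cons mem_rcons inE xl orbT.
have b0 : closed b by apply: w0; rewrite -rcons_cons mem_rcons mem_head.
rewrite foldl_rcons -/P bv_seven_closed // [G (mul P _)]bv_comm_apply //.
rewrite [G (mul b _)]bv_comm_apply // !scalerA -!ksgnD.
rewrite (ksgn_eq (m := (hdeg P - 1) * hdeg b + _) (n := hdeg b * hdeg c)
  (c := hdeg P * hdeg b)); last by rewrite hdegD hdegM; ring.
rewrite (ksgn_eq (m := hdeg P + _) (n := hdeg P * (hdeg b + hdeg c)) (c := hdeg P));
  last by rewrite hdegD hdegM; ring.
rewrite (IH (fun z => G (mul z b))); last exact: hlinear_mulr.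
(* This leading term of the induction hypothesis cancels the last term of the seven-term
   identity. *)
have -> : G (mul (mul (D P) c) b) = ksgn (hdeg b * hdeg c) *: G (mul (mul (D P) b) c).
  rewrite -!(bv_assoc BV) mulrC.
  by rewrite (bv_comm_apply (G := fun z => G (mul (D P) z))) //; exact: hlinear_mull.
rewrite scalerDr scalerA ksgn_sq scale1r -!addrA; congr (_ + _).
rewrite [X in _ + X = _]addrC subrK addrC size_rcons [in RHS]big_nat_recr // scaler_sumr.
have sw : size (a :: l) = (size l).+1 by [].
congr (_ + _).
  apply: eq_big_nat => i; rewrite -sw => /andP[_ ilt].
  rewrite scalerA -foldl_rcons -[a :: rcons l b]rcons_cons nth_rcons ilt.
  rewrite positions_rcons eq_sym (ltn_eqF ilt) !map_rcons.
  by rewrite -(size_map (@hdeg k V) (a :: l)) gravity_sign_skip ?size_map.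
rewrite -sw -[a :: rcons l b]rcons_cons nth_rcons ltnn eqxx positions_rcons eqxx.
rewrite (@positionsT _ _ _ (a :: l)).
  rewrite mul_prod !map_rcons -(size_map (@hdeg k V) (a :: l)) gravity_sign_last2.
  by rewrite big_map -(hdeg_foldl cup).
by move=> r rl; rewrite (ltn_eqF rl).
Qed.

(** Induction on the last factor: pairs avoiding it come from the induction hypothesis multiplied by
    it, pairs containing it from [delta_prod_last]. *)
Lemma delta_prod x0 G a l : hlinear G -> (forall x, x \in a :: l -> closed x) ->
  G (D (prod a l)) =
    \sum_(0 <= j < (size l).+1) \sum_(0 <= i < j)
      gsgn (degs (a :: l)) i j
      *: G (prod (D (mul (nth x0 (a :: l) i) (nth x0 (a :: l) j)))
              (positions x0 (fun r => (r != i) && (r != j)) (a :: l))).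
Proof.
elim/last_ind: l G => [|l c IH] G HG w0.
  by rewrite big_nat1 big_geq // (hlinear0 HG) ?w0 ?mem_head.
have w0' x : x \in a :: l -> closed x.
  by move=> xl; apply: w0; rewrite -rcons_cons mem_rcons inE xl orbT.
have c0 : closed c by apply: w0; rewrite -rcons_cons mem_rcons mem_head.
rewrite foldl_rcons (delta_prod_last x0) // (IH (fun z => G (mul z c))) //; last first.
  exact: hlinear_mulr.
have sw : size (a :: l) = (size l).+1 by [].
rewrite size_rcons [in RHS]big_nat_recr //; congr (_ + _).
  apply: eq_big_nat => j; rewrite -sw => /andP[_ jlt].
  apply: eq_big_nat => i /andP[_ ij]; have ilt := ltn_trans ij jlt.
  rewrite -foldl_rcons -[a :: rcons l c]rcons_cons !nth_rcons ilt jlt.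
  rewrite positions_rcons ![size _ == _]eq_sym (ltn_eqF ilt) (ltn_eqF jlt) map_rcons.
  by rewrite gravity_sign_rcons ?size_map.
apply: eq_big_nat => i; rewrite -sw => /andP[_ ilt].
rewrite -[a :: rcons l c]rcons_cons !nth_rcons ilt ltnn eqxx.
rewrite positions_rcons eqxx andbF; congr (_ *: G (foldl _ _ _)).
by apply: eq_positions => r /= /ltn_eqF ->; rewrite andbT.
Qed.

End SecondOrderOperator.

(** * Gravity brackets from a BV algebra and maps b, i *)

Section GravityOfBV.
Context {k : fieldType} {V W : int -> lmodType k}.
Context (cup : forall p q, W p -> W q -> W (p + q)) (Delta : forall n, W n -> W (n + 1)).
Context (s : int) (rb ri : int -> int).
Context (b : forall n, V n -> W (rb n)) (i : forall n, W n -> V (ri n)).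

Local Notation B := (hmap b).
Local Notation I := (hmap i).
Local Notation mul := (hmul cup).
Local Notation D := (hmap Delta).
Local Notation br := (bi_bracket cup B I).

(** Covers both sequences: [s] is the degree of [b], namely 0 for cyclic and 1 for negative cyclic
    cohomology, and [i] has degree [1 - s]. *)
Lemma gravity_of_BV :
  is_BV_algebra cup Delta ->
  (forall n, rb n = n + s) -> (forall n, ri n = n + 1 - s) ->
  (forall n, linear (@b n)) -> (forall n, linear (@i n)) ->
  (forall x : homog W, B (I x) = D x) -> (forall n (x : V n), i (b x) = 0) ->
  is_gravity_algebra s br.
Proof.
move=> BV rbE riE b_linear i_linear bi ib; have mulP := bv_bilinear BV.
have degB x : hdeg (B x) = gdeg s x by rewrite {1}/hdeg /= rbE.
have hI n : hlinear (fun z => comp n (I z)) := hlinear_hmap (hlinear_comp n) i_linear.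
have IB0 n (x : homog V) : comp n (I (B x)) = 0.
  by apply: (hlinear0 (hlinear_comp n)); rewrite /hmap /= ib.
have D0 x : tagged (D (B x)) = 0.
  rewrite -bi /hmap /= ib.
  have := b_linear (ri (rb (tag x))) (-1) 0 0.
  by rewrite scaler0 addr0 scaleN1r addNr.
split.
- move=> x xs _; rewrite /gdeg [hdeg (br _ _)]riE -/(hdeg _) hdeg_foldl big_cons big_map.
  rewrite degB (eq_bigr _ (fun y _ => degB y)) /gdeg; ring.
- move=> p c x y xs n _.
  exact: (hlinear_hmap (hlinear_foldl mulP _ (hI n)) b_linear).
- move=> p c x y z xs ys n.
  rewrite /bi_bracket !map_cat !foldl_cat.
  exact: (hlinear_hmap (hlinear_mull mulP _ (hlinear_foldl mulP _ (hI n))) b_linear).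
move=> x1 xs ys n _ _ w.
pose G z := comp n (I (foldl mul z (map B ys))).
have HG : hlinear G by exact: (hlinear_foldl mulP _ (hI n)).
(* Since [D] is [B] after [I], this is the nested bracket on the right; for empty [ys] it is [I]
   after [B] after [I], which is zero. *)
transitivity (G (D (foldl mul (B x1) (map B xs)))); last first.
  by case: ys @G HG => [|y ys] G HG; rewrite /G -bi //= IB0.
rewrite (delta_prod BV (B x1)) //; last first.
  by move=> x; rewrite -map_cons => /mapP[y _ ->]; exact: D0.
rewrite size_map -[(size xs).+1]/(size w); apply: eq_big_nat => q /andP[_ qw].
apply: eq_big_nat => p /andP[_ pq]; have pw := ltn_trans pq qw.
rewrite -[B x1 :: _]/(map B w) -map_comp (eq_map (degB : _ =1 _)).
congr (_ *: _); rewrite /G /bi_bracket map_cat foldl_cat /= bi.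
by rewrite -[B x1 :: _]/(map B w) !(nth_map x1) // -map_positions.
Qed.

End GravityOfBV.

Theorem proposition8p4 (k : fieldType) (A : augDGA k)
    (cup : forall p q : int, HH A p -> HH A q -> HH A (p + q)) :
  is_BV_algebra cup (@bv_delta k A) ->
  is_gravity_algebra 0
    (bi_bracket cup (hmap (@hc_b k A)) (hmap (@hc_i k A))) /\
  is_gravity_algebra 1
    (bi_bracket cup (hmap (@hcneg_b k A)) (hmap (@hcneg_i k A))).
Proof.
move=> BV; split; apply: (gravity_of_BV BV) => //.
- by move=> n; rewrite addr0.
- by move=> n; rewrite subr0.
- by move=> n; have [] := hc_b_spec A n.
- by move=> n; have [] := hc_i_spec A n.
- by move=> n x; exact: hc_i_b.
- by move=> n; rewrite addrK.
- by move=> n; have [] := hcneg_b_spec A n.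
- by move=> n; have [] := hcneg_i_spec A n.
- by move=> x; rewrite /hmap /= hcneg_b_i.
- by move=> n x; exact: hcneg_i_b.
Qed.
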